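(* Fix $p\in(0,1)$. There exist $c_l>0$ and $\tilde\lambda\in(1-p,1)$ such that, if the lookahead lengths $(W_\lambda)_{\lambda\in(1-p,1)}$, $W_\lambda\ge 0$, satisfy $$W_\lambda\le c_l\ln\frac{1}{1-\lambda}\qquad\text{for all }\lambda\in(\tilde\lambda,1),$$ then the optimal time-average queue length satisfies $$\mathcal{Q}^*(\lambda,W_\lambda)=\Theta\left(\ln\frac{1}{1-\lambda}\right)\qquad\text{as }\lambda\to1.$$
   Context: Admission control model. Fix $p\in(0,1)$, $\lambda\in(1-p,1)$ and a lookahead length $W_\lambda\ge0$ (a deterministic number that may depend on $\lambda$). Time is continuous, $t\ge 0$. The input consists of two independent Poisson processes: $\mathcal A$ with rate $\lambda$ (job arrivals) and $\mathcal S$ with rate $1-p$ (service tokens). For $n\in\mathbb N=\{1,2,\dots\}$, let $Z_n$ be the time of the $n$th event of $\mathcal A\cup\mathcal S$, and let $R_n=1$ if this event is in $\mathcal A$ and $R_n=-1$ if it is in $\mathcal S$. There is one queue with infinite waiting room, of length $Q(t)\in\{0,1,2,\dots\}$ at time $t$, started from a finite initial length. Each arriving job is, at its arrival time, either admitted, in which case $Q$ increases by $1$, or diverted, in which case it leaves immediately and $Q$ is unchanged. At each service token, $Q$ decreases by $1$ if it is positive and stays at $0$ otherwise. A diversion policy $\pi$ outputs the decisions $H(n)=\mathbb I\{R_n=1\text{ and }\pi\text{ diverts at time }Z_n\}$, $n\in\mathbb N$. It must be $(t+W_\lambda)$-causal: at any time $t$ the realization of all events of $\mathcal A\cup\mathcal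 S$ in $[t,t+W_\lambda]$ is available to the decision maker, and the decision made at time $t$ does not depend on any event after time $t+W_\lambda$ (decisions may be randomized). The policy is feasible if $$\limsup_{N\to\infty}\frac{\lambda+1-p}{N}\,\mathbb E\Big(\sum_{n=1}^N H(n)\Big)\le p.$$ The time-average queue length under $\pi$ is $$\mathcal Q(\pi,\lambda,W_\lambda)=\limsup_{N\to\infty}\mathbb E\Big(\frac1N\sum_{n=1}^N Q(Z_n-)\Big),$$ where $Q(x-)=\lim_{y\uparrow x}Q(y)$, and $\mathcal Q^*(\lambda,W_\lambda)=\min_\pi\mathcal Q(\pi,\lambda,W_\lambda)$, the minimum being over all feasible diversion policies. Notation: $f(x)=\Theta(g(x))$ as $x\to1$ means that for every sequence $x_n\to1$, $0<\liminf_{n\to\infty} f(x_n)/g(x_n)\le\limsup_{n\to\infty}f(x_n)/g(x_n)<\infty$. Here $\lambda\to1$ is through values in $(1-p,1)$. *)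

(* Defs.v *)
(* MathComp-Analysis *)
From HB Require Import structures.
From mathcomp Require Export all_boot all_order all_algebra.
From mathcomp Require Export all_classical all_reals all_analysis.

Set Implicit Arguments.
Unset Strict Implicit.
Unset Printing Implicit Defensive.

Import Order.TTheory GRing.Theory Num.Theory.
Import numFieldNormedType.Exports.

Local Open Scope classical_set_scope.
Local Open Scope ring_scope.

Section poisson.
Context {d : measure_display} {T : measurableType d} {R : realType}.
Implicit Types (P : probability T R) (X Y : nat -> T -> R).

Definition sigma_gen X : set (set T) :=
  <<s [set E | exists k (B : set R), measurable B /\ E = X k @^-1` B] >>.

Definition independent_processes P X Y :=
  forall E F, sigma_gen X E -> sigma_gen Y F ->
    P (E `&` F) = (P E * P F)%E.

(* Some of the [B i] may be [setT], so every finite subfamily is covered. *)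
Definition mutually_independent P X :=
  forall (n : nat) (B : nat -> set R), (forall i, measurable (B i)) ->
    P (\bigcap_(i in `I_n) X i @^-1` B i) =
    (\prod_(i < n) P (X i @^-1` B i))%E.

Definition gap X (k : nat) (w : T) : R :=
  if k is j.+1 then X k w - X j w else X 0%N w.

(* [X k] is the time of the [k.+1]-st point.  Positivity and strict
   monotonicity hold for every outcome, not just almost every one: a path is
   a strictly increasing sequence in ]0, +oo[. *)
Definition poisson_process P (rate : R) X :=
  [/\ (forall k, measurable_fun setT (X k)),
      (forall k w, 0 < gap X k w),
      mutually_independent P (gap X) &
      forall k (B : set R), measurable B ->
        P (gap X k @^-1` B) = exponential_prob rate B].

End poisson.

Record input (R : realType) := Input {
  idisp : measure_display;
  ispace : measurableType idisp;
  iprob : probability ispace R;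
  arr : nat -> ispace -> R;
  svc : nat -> ispace -> R
}.

(* The two processes have almost surely no common point; as for monotonicity
   above, the version used is the one in which this holds for every outcome. *)
Definition admission_input (R : realType) (p lambda : R) (I : input R) :=
  [/\ poisson_process (iprob I) lambda (@arr _ I),
      poisson_process (iprob I) (1 - p) (@svc _ I),
      independent_processes (iprob I) (@arr _ I) (@svc _ I) &
      forall i j w, @arr _ I i w != @svc _ I j w].

Section model.
Context {R : realType} (I : input R).
Implicit Types (w : ispace I) (n m : nat) (t W : R).

(* [merged w n] is the pair of the numbers of arrivals and of service tokens
   among the first [n] events of the superposition. *)
Fixpoint merged w n : nat * nat :=
  if n is m.+1 then
    let: (i, j) := merged w m in
    if arr i w < svc j w then (i.+1, j) else (i, j.+1)
  else (0%N, 0%N).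

(* Events are numbered from 0: [Z n] and [is_arrival n] are the time and the
   mark of the [n.+1]-st event. *)
Definition Z n w : R :=
  Num.min (arr (merged w n).1 w) (svc (merged w n).2 w).

Definition is_arrival n w : bool :=
  arr (merged w n).1 w < svc (merged w n).2 w.

(* The number of events in [0, t]; the default is used only when there are
   infinitely many, which has probability 0. *)
Definition nevents t w : nat :=
  xget 0%N [set n | forall m, (Z m w <= t) = (m < n)%N].

(* [diverts n (w, u)]: the job arriving at the [n.+1]-st event is diverted,
   for input outcome [w] and outcome [u] of the policy's own randomization.
   The value is irrelevant when that event is a service token. *)
Record policy := Policy {
  rdisp : measure_display;
  rspace : measurableType rdisp;
  rprob : probability rspace R;
  diverts : nat -> ispace I * rspace -> bool
}.

Section fixed_policy.
Variable pi : policy.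
Implicit Type x : ispace I * rspace pi.

(* Taking the product makes the randomization independent of the input. *)
Definition expect (f : ispace I * rspace pi -> R) : \bar R :=
  (\int[iprob I \x rprob pi]_x (f x)%:E)%E.

(* The information carried by the events of [0, t] and the randomization. *)
Definition history t : set (set (ispace I * rspace pi)) :=
  <<s [set E | [\/ exists k s, s <= t /\ E = [set x | arr k x.1 <= s],
                   exists k s, s <= t /\ E = [set x | svc k x.1 <= s] |
                   exists B, measurable B /\ E = [set x | B x.2]]] >>.

(* The decision made at time [Z n] belongs to the stopped sigma-algebra of
   [history] at the stopping time [Z n + W]. *)
Definition causal W :=
  forall n t, history t [set x | diverts n x /\ Z n x.1 + W <= t].

Definition H n x : bool := is_arrival n x.1 && diverts n x.

Fixpoint queue_after (q0 : nat) n x : nat :=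
  if n is m.+1 then
    let q := queue_after q0 m x in
    if is_arrival m x.1 then (if H m x then q else q.+1) else q.-1
  else q0.

Definition Q (q0 : nat) t x : nat := queue_after q0 (nevents t x.1) x.

Definition Qleft (q0 : nat) t x : R := lim (((Q q0 y x)%:R : R) @[y --> t^'-]).

Definition feasible (p lambda : R) :=
  (limn_esup (fun N => ((lambda + 1 - p) / N%:R)%:E *
     expect (fun x => (\sum_(n < N) (H n x)%:R)%R)) <= p%:E)%E.

Definition avg_queue (q0 : nat) : \bar R :=
  limn_esup (fun N =>
    expect (fun x => N%:R^-1 * \sum_(n < N) Qleft q0 (Z n x.1) x)).

End fixed_policy.

Definition Qopt (p lambda W : R) (q0 : nat) : \bar R :=
  ereal_inf [set c | exists pi : policy,
    [/\ causal pi W, feasible pi p lambda & c = avg_queue pi q0]].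

End model.

(* f(x) = Theta(g(x)) as x -> a through values in D *)
Definition Theta (R : realType) (D : set R) (a : R) (f : R -> \bar R)
    (g : R -> R) :=
  forall x : nat -> R, (forall n, D (x n)) -> x @ \oo --> a ->
    let r n := (f (x n) * ((g (x n))^-1)%:E)%E in
    [/\ (0 < limn_einf r)%E, (limn_einf r <= limn_esup r)%E &
        (limn_esup r < +oo)%E].

(* Main.v *)
Require Import Defs.
From mathcomp Require Import measurable_realfun ring lra zify.

(* Upper bound: diverting exactly when the queue has length at least L turns
   the queue seen at events into a truncated random walk with upward drift.
   Since (mu / lambda) ^ Q with mu = 1 - p is a martingale away from the two
   ends, the queue is empty a fraction at most (mu / lambda) ^ L of the time, and
   the policy is feasible as soon as mu (mu / lambda) ^ L <= 1 - lambda, that is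
   for some L of order ell = ln (1 / (1 - lambda)).

   Lower bound: feasibility and the balance of the queue force the rate of wasted
   service tokens (those which find the queue empty) to be O(1 - lambda).  If the
   mean queue is at most c ell, then for many events the queue is at most K =
   O(c ell), and within the lookahead window at most L = O(W + 1) further jobs
   arrive.  What happens after the window is independent of all decisions made
   so far, so that K + L + 1 services in a row follow with probability
   (mu / (lambda + mu)) ^ (K + L + 1), and one of these tokens is wasted.  For
   small c and W / ell this probability is much larger than
   (1 - lambda) (K + L), a contradiction.  The only probabilistic input is
   memorylessness: at a time t, given the numbers i and j of past arrivals and
   tokens, the past is a function of the first i and j gaps and of the
   randomization, and the next gaps are independent of these. *)

(** A policy may be randomized and non-stationary, so no ergodic theorem or invariant law is
    available. Both bounds are telescoping sums of expectations over the first N events, valid from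
    any initial length, with final constants depending on [p] alone. A bounded time average does not
    bound the mean queue at each single event, yet the balance involves the mean at its end point;
    so the end point is chosen among the events where the mean is at most twice the average.

    Information comes in forms that do not match: memorylessness is stated for fixed numbers of past
    points, histories for a fixed time, whereas decisions up to event [n] see as far as the random
    time [Z n + W]. The first two agree, as traces, on the event that exactly [i] arrivals and [j]
    tokens have occurred by time [t]. The random time is rounded up to an integer, which is why
    windows of length [W + 1] appear. *)

Set Implicit Arguments.
Unset Strict Implicit.
Unset Printing Implicit Defensive.

Import Order.TTheory GRing.Theory Num.Theory.
Import numFieldNormedType.Exports.

Local Open Scope classical_set_scope.
Local Open Scope ring_scope.

(** * Exponential variables independent of a sigma-algebra *)

Section density.
Local Open Scope ereal_scope.
Context d (T : measurableType d) (R : realType).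
Variables (m nu : {measure set T -> \bar R}) (g : T -> R).
Hypotheses (mg : measurable_fun setT g) (g0 : forall x, (0 <= g x)%R).
Hypothesis nuE : forall A, measurable A -> nu A = \int[m]_(x in A) (g x)%:E.

Let mEg : measurable_fun setT (EFin \o g). Proof. exact/measurable_EFinP. Qed.

Let Eg0 x : 0 <= (g x)%:E. Proof. by rewrite lee_fin. Qed.

Import HBNNSimple.

(** The defining identity of a density covers indicators; linearity extends it to simple functions
    and monotone convergence to nonnegative measurable ones. *)
Lemma ge0_integral_density (f : T -> \bar R) :
  measurable_fun setT f -> (forall x, 0 <= f x) ->
  \int[nu]_x f x = \int[m]_x (f x * (g x)%:E).
Proof.
move=> mf f0.
pose f_ := nnsfun_approx measurableT mf.
have cvf x : (f_ n x)%:E @[n --> \oo] --> f x.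
  by apply: cvg_nnsfun_approx.
transitivity (limn (fun n => \int[nu]_x (f_ n x)%:E)).
  rewrite -monotone_convergence//.
  - by apply: eq_integral => y _; apply/esym/cvg_lim.
  - by move=> n; exact/measurable_EFinP/measurable_funP.
  - by move=> n y _; rewrite lee_fin.
  - by move=> y _ p q pq; rewrite lee_fin; exact/lefP/nd_nnsfun_approx.
transitivity (limn (fun n => \int[m]_x ((f_ n x)%:E * (g x)%:E))); last first.
  rewrite -monotone_convergence//.
  - apply: eq_integral => y _; apply/cvg_lim => //.
    rewrite muleC; under eq_fun do rewrite muleC.
    exact: cvgeZl.
  - by move=> n; apply: emeasurable_funM => //; exact/measurable_EFinP/measurable_funP.
  - by move=> n y _; rewrite mule_ge0// lee_fin.
  - move=> y _ p q pq; apply: lee_wpmul2r => //.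
    by rewrite lee_fin; exact/lefP/nd_nnsfun_approx.
congr (limn _); apply/funext => n.
transitivity (\sum_(k \in range (f_ n))
    \int[nu]_x (k * \1_(f_ n @^-1` [set k]) x)%:E).
  under eq_integral do rewrite fimfunE -fsumEFin//.
  rewrite ge0_integral_fsum//.
  - by move=> y; exact/measurable_EFinP/measurable_funM.
  - by move=> y x _; rewrite nnfun_muleindic_ge0.
transitivity (\sum_(k \in range (f_ n))
    \int[m]_x ((k * \1_(f_ n @^-1` [set k]) x)%:E * (g x)%:E)); last first.
  rewrite -ge0_integral_fsum//.
  - apply: eq_integral => x _.
    rewrite [in RHS]fimfunE -fsumEFin// ge0_mule_fsuml//.
    by move=> i; rewrite nnfun_muleindic_ge0.
  - move=> y; apply: emeasurable_funM => //.
    exact/measurable_EFinP/measurable_funM.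
  - by move=> y x _; rewrite mule_ge0// nnfun_muleindic_ge0.
apply: eq_fsbigr => r; rewrite inE => -[z _ <-].
have mz : measurable (f_ n @^-1` [set f_ n z]) by exact: measurable_sfunP.
under eq_integral do rewrite EFinM.
rewrite ge0_integralZl//; last 2 first.
  exact/measurable_EFinP/measurable_indic.
  by rewrite lee_fin.
rewrite integral_indic// setIT nuE// integral_mkcond.
under [RHS]eq_integral do rewrite EFinM -muleA.
rewrite ge0_integralZl//; last 3 first.
  apply: emeasurable_funM => //; exact/measurable_EFinP/measurable_indic.
  by move=> x _; rewrite mule_ge0// lee_fin.
  by rewrite lee_fin.
congr (_ * _); apply: eq_integral => x _.
rewrite patchE indicE; case: ifP => _; first by rewrite mul1e.
by rewrite mul0e.
Qed.

End density.

(** Bundles the measure with its probability structure, which depends on the proof of positivity. *)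
Definition exponential_law (R : realType) (la : R) (la0 : 0 < la) :
    probability (measurableTypeR R) R :=
  exponential_distribution_exponential_prob__canonical__probability_measure_Probability
    la0.

Section exponential_tail.
Context (R : realType).
Variables (la : R).
Hypothesis la0 : 0 < la.

Local Open Scope ereal_scope.

(** Exponential tilting: weighting the density of rate [la] by [expR (- c * b)] gives
    [la / (la + c)] times the density of rate [la + c], and what remains is a tail of the latter
    law. *)
Lemma integral_exponential_tail (c y : R) : (0 <= c)%R -> (0 <= y)%R ->
  \int[exponential_law la0]_b
     ((\1_[set b | (y < b)%R] b * expR (- c * b))%:E) =
  (la / (la + c) * expR (- (la + c) * y))%:E.
Proof.
move=> c0 y0.
pose rt : R := (la + c)%R.
have rt0 : (0 < rt)%R by rewrite ltr_wpDr.
have my : measurable [set b : R | (y < b)%R].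
  rewrite (_ : [set _ | _] = `]y, +oo[%classic) //.
  by apply/seteqP; split => x /=; rewrite in_itv/= andbT.
have mE (k : R) : measurable_fun setT (fun b : R => expR (k * b)).
  by apply: measurableT_comp => //; exact: measurable_funM.
rewrite (@ge0_integral_density _ _ _ lebesgue_measure
   (exponential_law la0) (exponential_pdf la)).
- transitivity (\int[exponential_law rt0]_(b in [set b : R | (y < b)%R]) cst ((la / rt)%:E) b).
    rewrite [RHS]integral_mkcond.
    rewrite (@ge0_integral_density _ _ _ lebesgue_measure
     (exponential_law rt0) (exponential_pdf rt)).
    + apply: eq_integral => b _; rewrite patchE indicE /=.
      case: ifPn => [/[!inE] /= yb|_]; last by rewrite mul0r !mul0e.
      rewrite mul1r -!EFinM !exponential_pdfE ?(le_trans y0 (ltW yb))//.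
      congr (_%:E). rewrite mulrCA -expRD mulrA divfK ?gt_eqF//.
      by congr (_ * expR _)%R; rewrite /rt; ring.
    + exact: measurable_exponential_pdf.
    + by move=> x; rewrite exponential_pdf_ge0// ltW.
    + by [].
    + by apply/(measurable_restrictT _ _).1 => //; exact: measurable_cst.
    + move=> x; rewrite patchE; case: ifP => // _.
      by rewrite lee_fin divr_ge0// ltW.
  rewrite integral_cst// [RHS]EFinM; congr (_ * _).
  have -> : [set b : R | (y < b)%R] = ~` `]-oo, y]%classic.
    apply/seteqP; split => x /=; rewrite in_itv/= => h; first by apply/negP; rewrite -ltNge.
    by rewrite ltNge; apply/negP.
  rewrite -[LHS]/(exponential_law rt0 (~` `]-oo, y]%classic)).
  rewrite probability_setC//.
  change (1 - exponential_prob rt `]-oo, y]%classic =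
    (expR (- (la + c) * y))%:E).
  (* The density vanishes below 0. The closed formula applied below is for intervals from 0 to a
     positive end, hence the separate case [y = 0]. *)
  have -> : exponential_prob rt `]-oo, y]%classic = exponential_prob rt `[0%R, y]%classic.
    rewrite /exponential_prob [LHS]integral_mkcond [RHS]integral_mkcond.
    apply: eq_integral => x _; rewrite !patchE !mem_setE !in_itv/=.
    case: (leP 0%R x) => //= x0; case: ifP => // _.
    by rewrite lt0_exponential_pdf.
  move: y0; rewrite le_eqVlt => /predU1P[<-|y0].
    rewrite mulr0 expR0 set_itv1 /exponential_prob integral_set1 sube0//.
  by rewrite exponential_prob_itv0c// oppeB// addeA subee// add0e.
- exact: measurable_exponential_pdf.
- by move=> x; rewrite exponential_pdf_ge0// ltW.
- by [].
- apply/measurable_EFinP; apply: measurable_funM; last exact: mE.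
  exact: measurable_indic.
- by move=> x; rewrite lee_fin mulr_ge0// expR_ge0.
Qed.

End exponential_tail.

Section freezing.
Context d (T : measurableType d) (R : realType) (P : probability T R).
Variables (G : set (set T)) (X : T -> measurableTypeR R).
Variable nu : probability (measurableTypeR R) R.
Hypothesis Gm : <<s G >> `<=` measurable.
Hypothesis mX : measurable_fun setT X.
Hypothesis indX : forall E B, <<s G >> E -> measurable B ->
  (P (E `&` X @^-1` B) = P E * nu B)%E.

(** The outcome seen through the sigma-algebra of [G] and the value of [X] are independent, so their
    joint law agrees with a product measure on rectangles, hence everywhere, and Fubini-Tonelli
    integrates [X] out with the first argument frozen. *)
Lemma freezing (h : g_sigma_algebraType G * measurableTypeR R -> \bar R) :
  measurable_fun setT h -> (forall z, 0 <= h z)%E ->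
  (\int[P]_x h (x, X x) = \int[P]_x \int[nu]_b h (x, b))%E.
Proof.
move=> mh h0.
pose TG := g_sigma_algebraType G.
pose i : T -> TG := id.
have mi : measurable_fun setT i.
  by move=> _ B mB; rewrite setTI; exact: Gm.
pose PG : probability TG R := distribution P (mfun_Sub (mem_set mi)).
pose pr (x : T) : TG * measurableTypeR R := (i x, X x).
have mpr : measurable_fun setT pr by exact: measurable_fun_pair.
transitivity (\int[pushforward P pr]_z h z)%E.
  rewrite ge0_integral_pushforward//.
transitivity (\int[PG \x nu]_z h z)%E.
  apply: eq_measure_integral => A mA _; apply/esym.
  apply: (@product_measure_unique _ _ TG (measurableTypeR R) R PG nu) => // B C mB mC.
rewrite fubini_tonelli1//=.
rewrite ge0_integral_pushforward//.
  by apply: measurable_fun_fubini_tonelli_F.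
by move=> x _; exact: integral_ge0.
Qed.

End freezing.

Lemma measurable_set_bool d (T : measurableType d) (b : T -> bool) :
  measurable_fun setT b -> measurable [set x | b x].
Proof. by move=> mb; have := mb measurableT [set true] I; rewrite setTI. Qed.

Lemma measurable_set_lt d (T : measurableType d) (R : realType) (f g : T -> R) :
  measurable_fun setT f -> measurable_fun setT g ->
  measurable [set x | f x < g x].
Proof. by move=> mf mg; apply: measurable_set_bool; exact: measurable_fun_ltr. Qed.

Section freezing_exponential.
Context d (T : measurableType d) (R : realType) (P : probability T R).
Variables (G : set (set T)) (X : T -> measurableTypeR R) (la : R).
Hypothesis la0 : 0 < la.
Hypothesis Gm : <<s G >> `<=` measurable.
Hypothesis mX : measurable_fun setT X.
Hypothesis indX : forall E B, <<s G >> E -> measurable B ->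
  (P (E `&` X @^-1` B) = P E * exponential_prob la B)%E.

(** The integrand is kept exponential in [X] so that the result has the same shape: clocks can be
    integrated out one after the other, and [c = 0] gives probabilities. *)
Lemma freezing_exponential (E : set T) (x y : g_sigma_algebraType G -> R) (c : R) :
  <<s G >> E -> measurable_fun setT x -> measurable_fun setT y ->
  (forall z, E z -> 0 <= y z) -> 0 <= c ->
  (\int[P]_(z in E `&` [set z | (y z < X z)%R]) (expR (x z - c * X z))%:E =
   (la / (la + c))%:E * \int[P]_(z in E) (expR (x z - (la + c) * y z))%:E)%E.
Proof.
move=> GE mx my y0 c0.
have mT (f : g_sigma_algebraType G -> R) : measurable_fun setT f ->
    measurable_fun (setT : set T) f.
  by move=> mf _ B mB; apply: Gm; exact: mf.
pose TG := g_sigma_algebraType G.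
pose h (z : TG * measurableTypeR R) : \bar R :=
  (\1_(E : set TG) z.1 * (\1_[set b : R | y z.1 < b] z.2 * expR (- c * z.2)
    * expR (x z.1)))%:E.
have mf1 : measurable_fun setT (fst : TG * measurableTypeR R -> TG).
  exact: measurable_fst.
have mf2 : measurable_fun setT (snd : TG * measurableTypeR R -> R).
  exact: (@measurable_snd _ _ TG (measurableTypeR R)).
have mh : measurable_fun setT h.
  apply/measurable_EFinP/measurable_funM.
    by apply: measurableT_comp mf1; apply: measurable_indic.
  apply: measurable_funM; last first.
    by apply: (measurableT_comp (@measurable_expR R)); exact: measurableT_comp.
  apply: measurable_funM; last first.
    apply: (measurableT_comp (@measurable_expR R)).
    by apply: measurable_funM => //; exact: measurable_cst.
  rewrite (_ : (fun _ => _) =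
    \1_[set z : TG * measurableTypeR R | y z.1 < (z.2 : R)]) //.
  apply: measurable_indic.
  apply: measurable_set_lt => //; exact: measurableT_comp.
have h0 z : (0 <= h z)%E.
  by rewrite /h lee_fin !mulr_ge0// ?expR_ge0.
transitivity (\int[P]_z h (z, X z))%E.
  rewrite integral_mkcond; apply: eq_integral => z _.
  rewrite patchE /h /= !indicE in_setI.
  case: (z \in E) => /=; last by rewrite mul0r.
  rewrite mul1r.
  rewrite (_ : (z \in [set z | y z < X z]) = (X z \in [set b | y z < b])); last first.
    by apply/idP/idP; rewrite !inE.
  case: (X z \in _); last by rewrite !mul0r.
  by rewrite mul1r -expRD mulNr addrC.
rewrite (@freezing _ T R P G X (exponential_law la0) Gm mX indX _ mh h0).
rewrite [in RHS]integral_mkcond -ge0_integralZl//; last 3 first.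
- apply/(measurable_restrictT _ _).1; first exact: Gm.
  apply: measurable_funTS; apply/measurable_EFinP.
  apply: measurableT_comp => //; apply: measurable_funB; first exact: mT.
  by apply: measurable_funM => //; exact: mT.
- by move=> z _; rewrite patchE; case: ifP => // _; rewrite lee_fin expR_ge0.
- by rewrite lee_fin divr_ge0 ?addr_ge0// ltW.
apply: eq_integral => z _; rewrite /h /= patchE indicE.
case: ifPn => [/set_mem Ez|_]; last first.
  rewrite mule0 (eq_integral (cst 0%E)) ?integral0// => b _.
  by rewrite mul0r.
under eq_integral do rewrite mul1r EFinM.
rewrite ge0_integralZr//.
- rewrite (integral_exponential_tail la0 c0 (y0 _ Ez)) -!EFinM; congr EFin.
  by rewrite -[_ * expR _ * expR _]mulrA -expRD; congr (_ * expR _); ring.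
- apply/measurable_EFinP; apply: measurable_funM.
    apply: measurable_indic; apply: measurable_set_lt => //.
  apply: measurableT_comp => //; exact: measurable_funM.
Qed.

End freezing_exponential.

(** * Two independent Poisson clocks *)

(** Point number [i] when points are counted from 1, with [r0] as point 0: [gap X i] runs from
    [last_point 0 X i] to [X i]. *)
Definition last_point (T R : Type) (r0 : R) (X : nat -> T -> R) (i : nat) (w : T) : R :=
  if i is k.+1 then X k w else r0.

Section clocks.
Context d (T : measurableType d) (R : realType).
Implicit Types (A S : nat -> T -> R).

(** The pi-system on which [clock_ind] is a product formula. The sets of [past] are stated through
    points rather than gaps, because histories and comparisons of the two clocks are. *)
Definition rect A S (U : set (set T)) i j : set (set T) :=
  [set E | exists (B C : nat -> set R) D,
    [/\ forall k, measurable (B k), forall k, measurable (C k), U D &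
     E = \bigcap_(k in `I_i) gap A k @^-1` B k `&`
         \bigcap_(k in `I_j) gap S k @^-1` C k `&` D]].

Definition past A S (U : set (set T)) i j : set (set T) :=
  [set E | [\/ exists k B, [/\ (k < i)%N, measurable B & E = A k @^-1` B],
               exists k B, [/\ (k < j)%N, measurable B & E = S k @^-1` B] |
               U E]].

(* [U] is a pi-system independent of both clocks: it carries the events of the
   policy's own randomization. *)
Record clocks (P : probability T R) (la mu : R) A S (U : set (set T)) : Prop :=
  Clocks {
  clock_rateA : 0 < la;
  clock_rateS : 0 < mu;
  clock_mA : forall k, measurable_fun setT (A k);
  clock_mS : forall k, measurable_fun setT (S k);
  clock_gapA : forall k w, 0 < gap A k w;
  clock_gapS : forall k w, 0 < gap S k w;
  clock_neq : forall i j w, A i w != S j w;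
  clock_mU : U `<=` measurable;
  clock_UI : setI_closed U;
  clock_UT : U setT;
  clock_ind : forall i j (B C : nat -> set R) D,
    (forall k, measurable (B k)) -> (forall k, measurable (C k)) -> U D ->
    P (\bigcap_(k in `I_i) gap A k @^-1` B k `&`
       \bigcap_(k in `I_j) gap S k @^-1` C k `&` D) =
    (\prod_(k < i) exponential_prob la (B k) *
     \prod_(k < j) exponential_prob mu (C k) * P D)%E }.

Lemma clocks_sym P la mu A S U :
  clocks P la mu A S U -> clocks P mu la S A U.
Proof.
case=> la0 mu0 mA mS gA gS AS mU UI UT ind.
apply: (Clocks mu0 la0 mS mA gS gA _ mU UI UT) => [i j w|i j B C D mB mC UD].
  by rewrite eq_sym.
by rewrite (setIC (\bigcap_(_ in _) _)) ind// (muleC (\prod_(k < j) _)%E).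
Qed.

Lemma past_sym A S U i j : past A S U i j = past S A U j i.
Proof.
apply/seteqP; split => E [H|H|H];
  by [constructor 2|constructor 1|constructor 3].
Qed.

Section theory.
Variables (P : probability T R) (la mu : R) (A S : nat -> T -> R).
Variable (U : set (set T)).
Hypothesis cl : clocks P la mu A S U.

Notation TG i j := (g_sigma_algebraType (past A S U i j)).

Lemma gapE X k (w : T) : gap X k w = X k w - last_point 0 X k w :> R.
Proof. by case: k => [|k] //=; rewrite subr0. Qed.

Lemma measurable_gap X k :
  (forall k, measurable_fun setT (X k)) -> measurable_fun setT (gap X k : T -> R).
Proof.
case: k => [|k] mX; first exact: mX.
by rewrite (_ : gap X k.+1 = X k.+1 \- X k) //; exact: measurable_funB.
Qed.

Lemma past_measurable i j : <<s past A S U i j >> `<=` measurable.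
Proof.
apply: smallest_sub; first exact: sigma_algebra_measurable.
move=> E [[k [B [_ mB ->]]]|[k [B [_ mB ->]]]|]; last exact: (clock_mU cl).
- by rewrite -[X in measurable X]setTI; exact: (clock_mA cl).
- by rewrite -[X in measurable X]setTI; exact: (clock_mS cl).
Qed.

Lemma rect_measurable i j : rect A S U i j `<=` measurable.
Proof.
move=> _ [B [C [D [mB mC UD ->]]]].
apply: measurableI; last exact: (clock_mU cl).
apply: measurableI; apply: bigcap_measurableType => // k _;
  rewrite -[X in measurable X]setTI; apply: measurable_gap => //.
- exact: (clock_mA cl).
- exact: (clock_mS cl).
Qed.

Lemma rect_setI i j : setI_closed (rect A S U i j).
Proof.
move=> _ _ [B [C [D [mB mC UD ->]]]] [B' [C' [D' [mB' mC' UD' ->]]]].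
exists (fun k => B k `&` B' k), (fun k => C k `&` C' k), (D `&` D'); split.
- by move=> k; exact: measurableI.
- by move=> k; exact: measurableI.
- exact: (clock_UI cl).
- rewrite setIACA; congr (_ `&` _); rewrite setIACA; congr (_ `&` _);
    by rewrite -bigcapI.
Qed.

Lemma rect_setT i j : rect A S U i j setT.
Proof.
exists (fun=> setT), (fun=> setT), setT; split => //; first exact: (clock_UT cl).
by apply/seteqP; split => // w _; split => //; split.
Qed.

Lemma rect_gapA i j k B : (k < i)%N -> measurable B ->
  rect A S U i j (gap A k @^-1` B).
Proof.
move=> ki mB; exists (fun l => if l == k then B else setT), (fun=> setT), setT.
split => //.
- by move=> l; case: ifP.
- exact: (clock_UT cl).
apply/seteqP; split => [w Bw|w [[/(_ k ki)/=]]]; last by rewrite eqxx.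
by split => //; split => // l li /=; case: eqP => // ->.
Qed.

Lemma rect_gapS i j k B : (k < j)%N -> measurable B ->
  rect A S U i j (gap S k @^-1` B).
Proof.
move=> ki mB; exists (fun=> setT), (fun l => if l == k then B else setT), setT.
split => //.
- by move=> l; case: ifP.
- exact: (clock_UT cl).
apply/seteqP; split => [w Bw|w [[_ /(_ k ki)/=]]]; last by rewrite eqxx.
by split => //; split => // l li /=; case: eqP => // ->.
Qed.

(** A point is the sum of the gaps up to it. *)
Lemma sub_past_rect i j : <<s past A S U i j >> `<=` <<s rect A S U i j >>.
Proof.
pose TR := g_sigma_algebraType (rect A S U i j).
have mg (X : nat -> T -> R) n :
    (forall k, (k < n)%N -> measurable_fun setT (gap X k : TR -> R)) ->
    forall k, (k < n)%N -> measurable_fun setT (X k : TR -> R).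
  move=> mX; elim=> [|k IH] kn; first exact: (mX 0%N).
  rewrite (_ : X k.+1 = gap X k.+1 \+ X k) //; last first.
    by apply/funext => w /=; rewrite subrK.
  by apply: measurable_funD; [exact: mX|apply: IH; exact: ltnW].
have mA k : (k < i)%N -> measurable_fun setT (A k : TR -> R).
  apply: mg => l li _ B mB; rewrite setTI; apply: sub_sigma_algebra.
  exact: rect_gapA.
have mS k : (k < j)%N -> measurable_fun setT (S k : TR -> R).
  apply: mg => l li _ B mB; rewrite setTI; apply: sub_sigma_algebra.
  exact: rect_gapS.
apply: smallest_sub; first exact: smallest_sigma_algebra.
move=> E [[k [B [kn mB ->]]]|[k [B [kn mB ->]]]|UE].
- by have := mA _ kn measurableT _ mB; rewrite setTI.
- by have := mS _ kn measurableT _ mB; rewrite setTI.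
- apply: sub_sigma_algebra; exists (fun=> setT), (fun=> setT), E.
  split => //; apply/seteqP; split => [w Ew|w []//].
  by split => //; split.
Qed.

(** For fixed [B] both sides are finite measures in [E]. On a rectangle of gaps the left side
    concerns a rectangle with one more factor, and agreement on a pi-system suffices. *)
Lemma past_indep_gapA i j E B : <<s past A S U i j >> E -> measurable B ->
  P (E `&` gap A i @^-1` B) = (P E * exponential_prob la B)%E.
Proof.
move=> /sub_past_rect GE mB.
pose la0 := clock_rateA cl.
have mgB : measurable (gap A i @^-1` B).
  rewrite -[X in measurable X]setTI; apply: measurable_gap => //.
  exact: (clock_mA cl).
have b0 : (0 <= exponential_law la0 B)%E by [].
have bfin : exponential_law la0 B \is a fin_num by exact: fin_num_measure.
pose r : {nonneg R} := NngNum (fine_ge0 b0).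
have rE : (r%:num)%:E = exponential_prob la B by rewrite /= fineK.
rewrite muleC -rE.
rewrite -[LHS]/(mrestr P mgB E) -[RHS]/(mscale r P E).
apply: (@g_sigma_algebra_measure_unique _ _ _ (rect A S U i j) _ (fun=> setT)) => //.
- exact: rect_measurable.
- by move=> _; exact: rect_setT.
- by rewrite bigcup_const.
- exact: rect_setI.
- move=> _ [B' [C [D [mB' mC UD ->]]]].
  set F := (X in mrestr P mgB X = _).
  rewrite -[LHS]/(P (F `&` gap A i @^-1` B)) -[RHS]/((r%:num)%:E * P F)%E rE.
  rewrite (clock_ind cl)//.
  pose B2 l := if l == i then B else B' l.
  have mB2 l : measurable (B2 l) by rewrite /B2; case: ifP.
  transitivity (P (\bigcap_(k in `I_i.+1) gap A k @^-1` B2 k `&`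
       \bigcap_(k in `I_j) gap S k @^-1` C k `&` D)).
    congr (P _); rewrite /F setIAC; congr (_ `&` _); rewrite setIAC.
    congr (_ `&` _).
    rewrite IIS bigcap_setU bigcap_set1 /B2 eqxx; congr (_ `&` _).
    apply: eq_bigcapr => l /= li; rewrite ifF//; apply/negbTE.
    by rewrite ltn_eqF.
  rewrite (clock_ind cl)// big_ord_recr/= {2}/B2 eqxx.
  under eq_bigr => l _ do rewrite /B2 ltn_eqF//.
  by rewrite !muleA [X in (X * _ * _)%E]muleC.
- by move=> _; rewrite /mrestr /= (le_lt_trans (probability_le1 _ _)) ?ltry// setTI.
Qed.

End theory.

End clocks.

Section past_theory.
Context d (T : measurableType d) (R : realType).
Variables (P : probability T R) (la mu : R) (A S : nat -> T -> R).
Variable (U : set (set T)).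
Hypothesis cl : clocks P la mu A S U.

Notation TG i j := (g_sigma_algebraType (past A S U i j)).

Lemma past_sub i j i' j' : (i <= i')%N -> (j <= j')%N ->
  <<s past A S U i j >> `<=` <<s past A S U i' j' >>.
Proof.
move=> ii jj; apply: smallest_sub; first exact: smallest_sigma_algebra.
move=> E pE; apply: sub_sigma_algebra.
case: pE => [[k [B [ki mB ->]]]|[k [B [kj mB ->]]]|UE].
- by constructor 1; exists k, B; split => //; exact: leq_trans ki ii.
- by constructor 2; exists k, B; split => //; exact: leq_trans kj jj.
- by constructor 3.
Qed.

Lemma past_measurable_fun_sub i j i' j' (f : T -> R) : (i <= i')%N -> (j <= j')%N ->
  measurable_fun setT (f : TG i j -> R) -> measurable_fun setT (f : TG i' j' -> R).
Proof. by move=> ii jj mf _ B mB; apply: (past_sub ii jj); exact: mf. Qed.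

Lemma past_measurableA i j k : (k < i)%N -> measurable_fun setT (A k : TG i j -> R).
Proof.
move=> ki _ B mB; rewrite setTI; apply: sub_sigma_algebra.
by constructor 1; exists k, B.
Qed.

Lemma past_measurableS i j k : (k < j)%N -> measurable_fun setT (S k : TG i j -> R).
Proof.
move=> ki _ B mB; rewrite setTI; apply: sub_sigma_algebra.
by constructor 2; exists k, B.
Qed.

Lemma past_measurable_lastA i j :
  measurable_fun setT (last_point 0 A i : TG i j -> R).
Proof. by case: i => [|i]; [exact: measurable_cst|exact: past_measurableA]. Qed.

Lemma past_measurable_lastS i j :
  measurable_fun setT (last_point 0 S j : TG i j -> R).
Proof. by case: j => [|j]; [exact: measurable_cst|exact: past_measurableS]. Qed.

Lemma past_setI i j E F : <<s past A S U i j >> E -> <<s past A S U i j >> F ->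
  <<s past A S U i j >> (E `&` F).
Proof. exact: (@measurableI _ (TG i j)). Qed.

Lemma past_lt i j (f g : T -> R) :
  measurable_fun setT (f : TG i j -> R) -> measurable_fun setT (g : TG i j -> R) ->
  <<s past A S U i j >> [set w | f w < g w].
Proof. exact: (@measurable_set_lt _ (TG i j)). Qed.

(** Subtracting the last arrival turns survival of the clock past [y] into a tail of the next gap,
    which is independent of the past; [y - last_point 0 A i] is the age of the clock at time [y]. *)
Lemma freezing_clockA i j (E : set T) (x y : T -> R) (c : R) :
  <<s past A S U i j >> E ->
  measurable_fun setT (x : TG i j -> R) -> measurable_fun setT (y : TG i j -> R) ->
  (forall w, E w -> last_point 0 A i w <= y w) -> 0 <= c ->
  (\int[P]_(w in E `&` [set w | (y w < A i w)%R]) (expR (x w - c * A i w))%:E =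
   (la / (la + c))%:E * \int[P]_(w in E)
     (expR (x w - c * last_point 0 A i w - (la + c) * (y w - last_point 0 A i w)))%:E)%E.
Proof.
move=> GE mx my Ey c0.
have ml := @past_measurable_lastA i j.
have -> : [set w | (y w < A i w)%R] =
    [set w | ((y \- last_point 0 A i) w < gap A i w)%R].
  by apply/seteqP; split => w /=; rewrite gapE ltrD2r.
rewrite -(@freezing_exponential _ T R P (past A S U i j) (gap A i) la
  (clock_rateA cl) (past_measurable cl (i:=i) (j:=j))
  (measurable_gap _ (clock_mA cl)) (past_indep_gapA cl (i:=i) (j:=j)) E
  (fun w => x w - c * last_point 0 A i w) (y \- last_point 0 A i) c)//.
- by apply: eq_integral => w _; congr (expR _)%:E; rewrite gapE; ring.
- by apply: measurable_funB => //; apply: measurable_funM.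
- exact: measurable_funB.
- by move=> w Ew /=; rewrite subr_ge0; exact: Ey.
Qed.

End past_theory.

(** * Runs of services after a given time *)

Section services.
Context d (T : measurableType d) (R : realType).
Variables (P : probability T R) (la mu : R) (A S : nat -> T -> R).
Variable (U : set (set T)).
Hypothesis cl : clocks P la mu A S U.

Notation TG i j := (g_sigma_algebraType (past A S U i j)).

Lemma freezing_clockS i j (E : set T) (x y : T -> R) (c : R) :
  <<s past A S U i j >> E ->
  measurable_fun setT (x : TG i j -> R) -> measurable_fun setT (y : TG i j -> R) ->
  (forall w, E w -> last_point 0 S j w <= y w) -> 0 <= c ->
  (\int[P]_(w in E `&` [set w | (y w < S j w)%R]) (expR (x w - c * S j w))%:E =
   (mu / (mu + c))%:E * \int[P]_(w in E)
     (expR (x w - c * last_point 0 S j w - (mu + c) * (y w - last_point 0 S j w)))%:E)%E.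
Proof. by rewrite past_sym; exact: (freezing_clockA (clocks_sym cl)). Qed.

(** The integrand is 1, written in the shape of the freezing lemmas with [c = 0]. *)
Lemma prob_expR0 (E : set T) (X : T -> R) : measurable E ->
  P E = (\int[P]_(w in E) (expR (0 - 0 * X w))%:E)%E.
Proof.
move=> mE; under eq_integral do rewrite mul0r subr0 expR0.
by rewrite integral_cst// mul1e.
Qed.

Section at_time.
Variables (i j : nat) (E : set T) (t : T -> R).
Hypotheses (GE : <<s past A S U i j >> E)
  (mt : measurable_fun setT (t : TG i j -> R))
  (At : forall w, E w -> last_point 0 A i w <= t w)
  (St : forall w, E w -> last_point 0 S j w <= t w).

Let la0 : 0 < la := clock_rateA cl.
Let mu0 : 0 < mu := clock_rateS cl.
Let mlA := @past_measurable_lastA _ T R A S U i j.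
Let mlS := @past_measurable_lastS _ T R A S U i j.
Let F := E `&` [set w | t w < S j w].

Let GF : <<s past A S U i j.+1 >> F.
Proof.
apply: past_setI; first exact: past_sub GE.
apply: past_lt; last exact: past_measurableS.
exact: past_measurable_fun_sub mt.
Qed.

(** Clock [A] is integrated out given the past and the next token, then clock [S]; each contributes
    the survival probability of its age at [t]. *)
Lemma wait_both :
  P (E `&` [set w | t w < S j w] `&` [set w | t w < A i w]) =
  (\int[P]_(w in E) (expR (- la * (t w - last_point 0 A i w)
                           - mu * (t w - last_point 0 S j w)))%:E)%E.
Proof.
have mtS := past_measurable_fun_sub (leqnn i) (leqnSn j) mt.
have mFA : <<s past A S U i.+1 j.+1 >> (F `&` [set w | t w < A i w]).
  apply: past_setI; first exact: past_sub GF.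
  apply: past_lt; last exact: past_measurableA.
  exact: past_measurable_fun_sub mt.
rewrite (prob_expR0 (A i) (past_measurable cl mFA)).
rewrite (freezing_clockA cl GF)//; last by move=> w [Ew _]; exact: At.
rewrite addr0 divff ?gt_eqF// mul1e.
transitivity (\int[P]_(w in F)
    (expR (- la * (t w - last_point 0 A i w) - 0 * S j w))%:E)%E.
  by apply: eq_integral => w _; congr (expR _)%:E; ring.
rewrite (freezing_clockS GE)//; last first.
  by apply: measurable_funM => //; exact: measurable_funB.
rewrite addr0 divff ?gt_eqF// mul1e.
by apply: eq_integral => w _; congr (expR _)%:E; ring.
Qed.

(** Integrating out [A] beyond the next token leaves an exponential of rate [la] in [S j], and [S]
    is then integrated out with this tilt. The ages at [t] come out exactly as in [wait_both], so
    that only the factor [mu / (la + mu)] differs. *)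
Lemma service_first :
  P (E `&` [set w | t w < S j w] `&` [set w | S j w < A i w]) =
  ((mu / (la + mu))%:E *
   P (E `&` [set w | (t w < S j w)%R] `&` [set w | (t w < A i w)%R]))%E.
Proof.
rewrite wait_both.
have mFA : <<s past A S U i.+1 j.+1 >> (F `&` [set w | S j w < A i w]).
  apply: past_setI; first exact: past_sub GF.
  by apply: past_lt; [exact: past_measurableS|exact: past_measurableA].
rewrite (prob_expR0 (A i) (past_measurable cl mFA)).
rewrite (freezing_clockA cl GF)//; last 2 first.
- exact: past_measurableS.
- by move=> w [Ew tS]; apply: (le_trans (At Ew)); exact: ltW.
rewrite addr0 divff ?gt_eqF// mul1e.
transitivity (\int[P]_(w in F)
    (expR (la * last_point 0 A i w - la * S j w))%:E)%E.
  by apply: eq_integral => w _; congr (expR _)%:E; ring.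
rewrite (freezing_clockS GE)//; last 2 first.
- exact: measurable_funM.
- exact: ltW.
rewrite addrC; congr (_ * _)%E.
by apply: eq_integral => w _; congr (expR _)%:E; ring.
Qed.

End at_time.

Section run.
Variables (i j : nat) (E : set T) (t : T -> R).
Hypotheses (GE : <<s past A S U i j >> E)
  (mt : measurable_fun setT (t : TG i j -> R))
  (At : forall w, E w -> last_point 0 A i w <= t w)
  (St : forall w, E w -> last_point 0 S j w <= t w).

Let F := E `&` [set w | t w < S j w].

Let GF : <<s past A S U i j.+1 >> F.
Proof.
apply: past_setI; first exact: past_sub GE.
apply: past_lt; last exact: past_measurableS.
exact: past_measurable_fun_sub mt.
Qed.

(** Each further service is [service_first] at the time of the preceding token: then [S (j + m)] is
    the last token and clock [A] is still waiting. *)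
Lemma services_run m :
  P (E `&` [set w | t w < S j w] `&` [set w | S (j + m)%N w < A i w]) =
  (((mu / (la + mu)) ^+ m.+1)%:E *
   P (E `&` [set w | (t w < S j w)%R] `&` [set w | (t w < A i w)%R]))%E.
Proof.
elim: m => [|m IH]; first by rewrite addn0 expr1 service_first.
rewrite addnS exprS EFinM -muleA -IH.
have GF' : <<s past A S U i (j + m).+1 >> F.
  by apply: past_sub GF => //; rewrite ltnS leq_addr.
have mS : measurable_fun setT (S (j + m)%N : TG i (j + m).+1 -> R).
  exact: past_measurableS.
have Sm w : S (j + m)%N w < S (j + m).+1 w.
  by rewrite -subr_gt0; exact: (clock_gapS cl (j + m).+1).
have jm w k : S j w <= S (j + k)%N w.
  elim: k => [|k IHk]; first by rewrite addn0.
  rewrite (le_trans IHk)// addnS ltW// -subr_gt0.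
  exact: (clock_gapS cl (j + k).+1).
transitivity (P (F `&` [set w | S (j + m)%N w < S (j + m).+1 w] `&`
    [set w | S (j + m).+1 w < A i w])).
  congr (P _); apply/seteqP; split => w /=.
  - by move=> [Fw h]; split => //; split.
  - by move=> [[Fw _] h]; split.
rewrite (service_first GF' mS) //; last first.
  by move=> w [Ew tS]; rewrite (le_trans (At Ew))// (le_trans (ltW tS)).
congr (_ * P _)%E; apply/seteqP; split => w /=.
- by move=> [[Fw _] h]; split.
- by move=> [Fw h]; split => //; split.
Qed.

End run.
End services.

(** * The merged sequence of events *)

Section path.
Context (R : realType) (I : input R) (w : ispace I).
Notation A := (@arr _ I).
Notation S := (@svc _ I).
Hypothesis gapA0 : forall k, 0 < gap A k w.
Hypothesis gapS0 : forall k, 0 < gap S k w.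
Hypothesis AS : forall i j, A i w != S j w.
Notation lastA i := (last_point 0 A i w).
Notation lastS j := (last_point 0 S j w).

Lemma lastA_lt i : lastA i < A i w.
Proof. by rewrite -subr_gt0 -gapE. Qed.

Lemma lastS_lt j : lastS j < S j w.
Proof. by rewrite -subr_gt0 -gapE. Qed.

Lemma arr_lt i k : (i < k)%N -> A i w < A k w.
Proof.
elim: k => // k IH; rewrite ltnS leq_eqVlt => /predU1P[->|/IH h].
  exact: (lastA_lt k.+1).
exact: (lt_trans h (lastA_lt k.+1)).
Qed.

Lemma svc_lt i k : (i < k)%N -> S i w < S k w.
Proof.
elim: k => // k IH; rewrite ltnS leq_eqVlt => /predU1P[->|/IH h].
  exact: (lastS_lt k.+1).
exact: (lt_trans h (lastS_lt k.+1)).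
Qed.

Lemma arr_le i k : (i <= k)%N -> A i w <= A k w.
Proof. by rewrite leq_eqVlt => /predU1P[->//|/arr_lt/ltW]. Qed.

Lemma svc_le i k : (i <= k)%N -> S i w <= S k w.
Proof. by rewrite leq_eqVlt => /predU1P[->//|/svc_lt/ltW]. Qed.

Lemma arr_gt0 k : 0 < A k w.
Proof. by apply: (lt_le_trans (lastA_lt 0)); exact: arr_le. Qed.

Lemma svc_gt0 k : 0 < S k w.
Proof. by apply: (lt_le_trans (lastS_lt 0)); exact: svc_le. Qed.

Lemma lastA_le i k : (i <= k)%N -> lastA i <= lastA k.
Proof.
case: i k => [|i] [|k] // ik; [exact/ltW/arr_gt0|exact: arr_le].
Qed.

Lemma lastS_le i k : (i <= k)%N -> lastS i <= lastS k.
Proof.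
case: i k => [|i] [|k] // ik; [exact/ltW/svc_gt0|exact: svc_le].
Qed.

Lemma is_arrivalE n i j : merged w n = (i, j) -> is_arrival n w = (A i w < S j w).
Proof. by rewrite /is_arrival => ->. Qed.

Lemma is_serviceE n i j : merged w n = (i, j) ->
  ~~ is_arrival n w = (S j w < A i w).
Proof. by move=> /is_arrivalE ->; rewrite -leNgt le_eqVlt eq_sym (negbTE (AS _ _)). Qed.

Lemma mergedS n i j : merged w n = (i, j) ->
  merged w n.+1 = if is_arrival n w then (i.+1, j) else (i, j.+1).
Proof. by move=> e; rewrite (is_arrivalE e) /= e. Qed.

Lemma merged_sum n : ((merged w n).1 + (merged w n).2 = n)%N.
Proof.
elim: n => // n; case e : (merged w n) => [i j] /= ij; rewrite e.
by case: ifP => _ /=; rewrite ?addSn ?addnS ij.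
Qed.

(** With its converse, this replaces the recursive merge by comparisons of points, the form in which
    clocks and histories can handle it. *)
Lemma merged_interlace n i j : merged w n = (i, j) ->
  lastA i < S j w /\ lastS j < A i w.
Proof.
elim: n i j => [|n IH] i j.
  by case=> <- <-; split; [exact: svc_gt0|exact: arr_gt0].
case e : (merged w n) => [k l]; have [h1 h2] := IH _ _ e.
rewrite (mergedS e); case: ifPn.
  rewrite (is_arrivalE e) => h [<- <-]; split => //=.
  exact: (lt_trans h2 (lastA_lt k.+1)).
rewrite (is_serviceE e) => h [<- <-]; split => //=.
exact: (lt_trans h1 (lastS_lt l.+1)).
Qed.

(** The true counts have the same sum as [(i, j)]; if they differed, one would be larger and the
    other smaller, and the two interlacings would contradict each other. *)
Lemma interlace_merged i j : lastA i < S j w -> lastS j < A i w ->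
  merged w (i + j) = (i, j).
Proof.
move=> h1 h2; case e : (merged w (i + j)) => [k l].
have := merged_sum (i + j); rewrite e /= => kl.
have [g1 g2] := merged_interlace e.
have [ki|ki|ki] := ltngtP k i.
- have jl : (j < l)%N by lia.
  have := le_lt_trans (@lastA_le k.+1 i ki) h1.
  move=> /lt_le_trans /(_ (@lastS_le j.+1 l jl)) /= /lt_trans /(_ g2).
  by rewrite ltxx.
- have jl : (l < j)%N by lia.
  have := le_lt_trans (@lastS_le l.+1 j jl) h2.
  move=> /lt_le_trans /(_ (@lastA_le i.+1 k ki)) /= /lt_trans /(_ g1).
  by rewrite ltxx.
- by congr pair => //; lia.
Qed.

(** This is the shape of [wait_both] at the time of the last event: neither clock has rung since. *)
Lemma merged_interlaceE i j :
  (merged w (i + j) == (i, j)) = (Num.max (lastA i) (lastS j) < S j w) &&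
    (Num.max (lastA i) (lastS j) < A i w).
Proof.
rewrite !gt_max lastA_lt lastS_lt !andbT /=.
apply/eqP/andP => [/merged_interlace //|[h1 h2]]; exact: interlace_merged.
Qed.

Lemma mergedS_arrival n i j : merged w n.+1 = (i, j) ->
  is_arrival n w = (lastS j < lastA i).
Proof.
case e : (merged w n) => [k l]; have [h1 h2] := merged_interlace e.
rewrite (mergedS e); case: ifPn => [_ [<- <-]|_ [<- <-]] /=; first by rewrite h2.
by apply/esym/negbTE; rewrite -leNgt ltW.
Qed.

Lemma last_ZE n i j : merged w n = (i, j) ->
  last_point 0 (@Z _ I) n w = Num.max (lastA i) (lastS j).
Proof.
case: n => [|n]; first by case=> <- <-; rewrite /= maxxx.
case e : (merged w n) => [k l]; have [h1 h2] := merged_interlace e.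
rewrite (mergedS e) /= /Z e /=; case: ifPn.
  rewrite (is_arrivalE e) => h [<- <-] /=.
  by rewrite (min_idPl (ltW h)) (max_idPl (ltW h2)).
rewrite (is_serviceE e) => h [<- <-] /=.
by rewrite (min_idPr (ltW h)) (max_idPr (ltW h1)).
Qed.

Lemma last_Z_lt n : last_point 0 (@Z _ I) n w < Z n w.
Proof.
case e : (merged w n) => [i j]; have [h1 h2] := merged_interlace e.
rewrite (last_ZE e) /Z e /= gt_max !lt_min lastA_lt lastS_lt h1 h2 //.
Qed.

Lemma Z_lt m n : (m < n)%N -> Z m w < Z n w.
Proof.
elim: n => // n IH; rewrite ltnS leq_eqVlt => /predU1P[->|/IH h].
  exact: (last_Z_lt n.+1).
exact: (lt_trans h (last_Z_lt n.+1)).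
Qed.

Lemma Z_le m n : (m <= n)%N -> Z m w <= Z n w.
Proof. by rewrite leq_eqVlt => /predU1P[->//|/Z_lt/ltW]. Qed.

Lemma Z_gt0 n : 0 < Z n w.
Proof. by apply: (lt_le_trans (last_Z_lt 0)); exact: Z_le. Qed.

Lemma nevents_lt n y : last_point 0 (@Z _ I) n w <= y < Z n w -> nevents y w = n.
Proof.
move=> /andP[h1 h2]; rewrite /nevents.
have P0 m : (Z m w <= y) = (m < n)%N.
  case: (ltnP m n) => mn; last by rewrite leNgt (lt_le_trans h2)// Z_le.
  case: n mn h1 h2 => // n; rewrite ltnS => mn h1 _.
  exact: (le_trans (Z_le mn) h1).
case: xgetP => [k _ Pk|/(_ n)]; last by move=> /(_ P0).
have [kn|kn|//] := ltngtP k n.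
- by have := P0 k; rewrite kn Pk ltnn.
- by have := Pk n; rewrite kn P0 ltnn.
Qed.

(** No event falls strictly between the preceding one and [Z n], so the queue is constant on a left
    neighbourhood of [Z n]. *)
Lemma QleftE (pi : policy I) (u : rspace pi) q0 n :
  Qleft q0 (Z n w) (w, u) = (queue_after q0 n (w, u))%:R.
Proof.
rewrite /Qleft; apply/cvg_lim => //.
apply: cvg_near_cst; near=> y.
rewrite /Q (@nevents_lt n)//; apply/andP; split.
  near: y; apply: nbhs_left_ge; exact: last_Z_lt.
by near: y; exact: nbhs_left_lt.
Unshelve. all: by end_near.
Qed.

End path.

(** * The input, with the randomization, as a pair of clocks *)

Section input_clocks.
Context (R : realType) (p lambda : R) (I : input R).
Hypothesis hI : admission_input p lambda I.
Hypotheses (lambda0 : 0 < lambda) (p1 : p < 1).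
Variable pi : policy I.

Notation Omega := (ispace I * rspace pi)%type.
Notation A := (fun k (x : Omega) => arr k x.1).
Notation S := (fun k (x : Omega) => svc k x.1).

Definition joint_prob : probability (ispace I * rspace pi)%type R :=
  (iprob I \x rprob pi)%E.

Definition randomization : set (set (ispace I * rspace pi)) :=
  [set E | exists2 B, measurable B & E = [set x | B x.2]].

Lemma sigma_gen_gap (X : nat -> ispace I -> R) n (B : nat -> set R) :
  (forall k, measurable (B k)) ->
  sigma_gen X (\bigcap_(k in `I_n) gap X k @^-1` B k).
Proof.
move=> mB; pose G : set (set (ispace I)) :=
  [set E | exists k (B : set R), measurable B /\ E = X k @^-1` B].
pose TG := g_sigma_algebraType G.
have mX k : measurable_fun setT (X k : TG -> R).
  by move=> _ C mC; rewrite setTI; apply: sub_sigma_algebra; exists k, C.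
apply: (@bigcap_measurableType _ TG) => k _.
have := @measurable_gap _ TG R X k mX measurableT _ (mB k).
by rewrite setTI.
Qed.

Lemma input_clocks : clocks joint_prob lambda (1 - p) A S randomization.
Proof.
case: hI => -[mA gA iA lA] [mS gS iS lS] ind neq.
apply: Clocks => //.
- by rewrite subr_gt0.
- by move=> k; exact: measurableT_comp (mA k) _.
- by move=> k; exact: measurableT_comp (mS k) _.
- by move=> [|k] w; [exact: (gA 0%N w.1)|exact: (gA k.+1 w.1)].
- by move=> [|k] w; [exact: (gS 0%N w.1)|exact: (gS k.+1 w.1)].
- move=> E [B mB ->].
  have := @measurable_snd _ _ (ispace I) (rspace pi) measurableT _ mB.
  by rewrite setTI.
- move=> _ _ [B mB ->] [C mC ->]; exists (B `&` C) => //.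
  exact: measurableI.
- by exists setT.
- move=> i j B C _ mB mC [D mD ->].
  rewrite (_ : _ `&` _ = (\bigcap_(k in `I_i) gap (@arr _ I) k @^-1` B k `&`
       \bigcap_(k in `I_j) gap (@svc _ I) k @^-1` C k) `*` D); last first.
    apply/seteqP; split => -[w u] [[h1 h2] h3]; split=> //; split.
  have m1 : measurable (\bigcap_(k in `I_i) gap (@arr _ I) k @^-1` B k).
    apply: bigcap_measurableType => k _; rewrite -[X in measurable X]setTI.
    exact: measurable_gap.
  have m2 : measurable (\bigcap_(k in `I_j) gap (@svc _ I) k @^-1` C k).
    apply: bigcap_measurableType => k _; rewrite -[X in measurable X]setTI.
    exact: measurable_gap.
  rewrite [LHS]product_measure1E//; last exact: measurableI.
  rewrite (_ : [set x : Omega | D x.2] = setT `*` D); last first.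
    by apply/seteqP; split => -[w u] //= [].
  rewrite [X in (_ = _ * X)%E]product_measure1E//.
  rewrite [X in (_ = _ * (X * _))%E]probability_setT mul1e.
  congr (_ * _)%E.
  rewrite [LHS]ind; [|exact: sigma_gen_gap|exact: sigma_gen_gap].
  congr (_ * _)%E.
  + by rewrite [LHS]iA//; apply: eq_bigr => k _; exact: lA.
  + by rewrite [LHS]iS//; apply: eq_bigr => k _; exact: lS.
Qed.

End input_clocks.

(** * Information in the first n events *)

Section trace.
Context (T : Type) (G : set (set T)).

(** [C] itself need not belong to the sigma-algebra: that the counts are [i] and [j] also involves
    the next points, which are not in the past. *)
Definition trace_of (C E : set T) := exists2 E', <<s G>> E' & E `&` C = E' `&` C.

Lemma trace_of_sigma_algebra (C : set T) : sigma_algebra setT (trace_of C).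
Proof.
have [s0 sC sU] := smallest_sigma_algebra setT G.
split.
- by exists set0.
- move=> E [E' GE' EE']; exists (setT `\` E'); first exact: sC.
  apply/seteqP; split => x /= [[_ Ex] Cx]; split => //; split => // Ex'; apply: Ex.
    by have [] : (E `&` C) x by rewrite EE'.
  by have [] : (E' `&` C) x by rewrite -EE'.
- move=> E /(_ _)/cid2-/all_sig2[E' GE' EE'].
  exists (\bigcup_k E' k); first exact: sU.
  by rewrite !setI_bigcupl; apply: eq_bigcupr => k _; exact: EE'.
Qed.

End trace.

Lemma prob_partition d (T : measurableType d) (R : realType) (P : probability T R)
    (F : nat -> set T) (N : nat) (E : set T) :
  (forall i, measurable (F i)) -> (forall x i j, F i x -> F j x -> i = j) ->
  measurable E -> (forall x, E x -> exists2 i, (i < N)%N & F i x) ->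
  P E = (\sum_(i < N) P (E `&` F i))%E.
Proof.
move=> mF tF mE EF.
rewrite -measure_bigsetU_ord//.
- congr (P _); rewrite -(bigcup_mkord _ (fun i => E `&` F i)).
  apply/seteqP; split => [x Ex|x [i _ []]//].
  by have [i iN Fi] := EF x Ex; exists i.
- by move=> i; exact: measurableI.
- move=> i j _ _ [x [[_ /= fi] [_ /= fj]]]; apply: val_inj => /=.
  exact: tF fi fj.
Qed.

Section steps.
Context (R : realType) (p lambda : R) (I : input R).
Hypothesis hI : admission_input p lambda I.
Hypotheses (lambda0 : 0 < lambda) (p1 : p < 1).
Variable pi : policy I.

Notation Omega := (ispace I * rspace pi)%type.
Notation A := (fun k (x : Omega) => arr k x.1).
Notation S := (fun k (x : Omega) => svc k x.1).
Notation U := (@randomization R I pi).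
Notation P := (joint_prob pi).
Notation mu := (1 - p).

Let cl : clocks P lambda mu A S U := input_clocks hI lambda0 p1 pi.

Lemma input_gapA k w : 0 < gap (@arr _ I) k w. Proof. by case: hI => -[]. Qed.
Lemma input_gapS k w : 0 < gap (@svc _ I) k w. Proof. by case: hI => _ []. Qed.
Lemma input_neq w i j : @arr _ I i w != svc j w. Proof. by case: hI. Qed.

Definition counts n i j : set Omega := [set x | merged x.1 n = (i, j)].

(* The sigma-algebra of the first [n] events and of the randomization. *)
Definition upto n : set (set Omega) :=
  [set E | forall i j, trace_of (past A S U i j) (counts n i j) E].

Lemma upto_sigma_algebra n : sigma_algebra setT (upto n).
Proof.
split.
- by move=> i j; have [] := trace_of_sigma_algebra (past A S U i j) (counts n i j).
- move=> E GE i j.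
  have [_ + _] := trace_of_sigma_algebra (past A S U i j) (counts n i j).
  by apply; exact: GE.
- move=> E GE i j.
  have [_ _] := trace_of_sigma_algebra (past A S U i j) (counts n i j).
  by apply => k; exact: GE.
Qed.

Notation TU n := (g_sigma_algebraType (upto n)).

Lemma upto_g n : <<s upto n >> = upto n.
Proof. exact/sigma_algebra_id/upto_sigma_algebra. Qed.

Definition last_event i j (x : Omega) : R :=
  Num.max (last_point 0 A i x) (last_point 0 S j x).

Lemma last_point_arr i (x : Omega) : last_point 0 A i x = last_point 0 (@arr _ I) i x.1.
Proof. by case: i. Qed.

Lemma last_point_svc i (x : Omega) : last_point 0 S i x = last_point 0 (@svc _ I) i x.1.
Proof. by case: i. Qed.

Lemma countsE n i j : counts n i j = if (i + j == n)%N then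
  [set x | last_event i j x < S j x] `&` [set x | last_event i j x < A i x]
  else set0.
Proof.
case: eqP => [<-|ijn]; apply/seteqP; split => x //=.
- rewrite /counts /= => /eqP.
  rewrite (merged_interlaceE (input_gapA ^~ _) (input_gapS ^~ _) (input_neq _)).
  by rewrite /last_event last_point_arr last_point_svc => /andP.
- rewrite /last_event last_point_arr last_point_svc => -[h1 h2].
  apply/eqP; rewrite (merged_interlaceE (input_gapA ^~ _) (input_gapS ^~ _) (input_neq _)).
  by rewrite h1 h2.
- by rewrite /counts /= => h; have := merged_sum x.1 n; rewrite h.
Qed.

Lemma past_measurable_last_event i j :
  measurable_fun setT (last_event i j : g_sigma_algebraType (past A S U i j) -> R).
Proof.
apply: measurable_maxr.
- exact: past_measurable_lastA.
- exact: past_measurable_lastS.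
Qed.

Lemma counts_past n i j : <<s past A S U i.+1 j.+1 >> (counts n i j).
Proof.
rewrite countsE; case: ifP => _; last first.
  by have [] := smallest_sigma_algebra setT (past A S U i.+1 j.+1).
have ml := past_measurable_fun_sub (leqnSn i) (leqnSn j) (@past_measurable_last_event i j).
apply: past_setI; apply: past_lt => //.
- exact: past_measurableS.
- exact: past_measurableA.
Qed.

Lemma counts_measurable n i j : measurable (counts n i j).
Proof. exact: (past_measurable cl (@counts_past n i j)). Qed.

Lemma trace_measurable n i j E :
  trace_of (past A S U i j) (counts n i j) E -> measurable (E `&` counts n i j).
Proof.
move=> [E' GE ->]; apply: measurableI; last exact: counts_measurable.
exact: (past_measurable cl GE).
Qed.

Lemma counts_arrivals n i : [set x : Omega | (merged x.1 n).1 = i] =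
  if (i <= n)%N then counts n i (n - i) else set0.
Proof.
case: ifPn => ni; apply/seteqP; split => x //=.
- move=> h; rewrite /counts /=; have := merged_sum x.1 n.
  by case: merged h => a b /= ->; move=> <-; rewrite addKn.
- by rewrite /counts /= => ->.
- by move=> h; have := merged_sum x.1 n; rewrite h => ij; move: ni; rewrite -ij leq_addr.
Qed.

Lemma counts_partition n (E : set Omega) : measurable E ->
  P E = (\sum_(i < n.+1) P (E `&` counts n i (n - i)))%E.
Proof.
move=> mE; rewrite (@prob_partition _ _ _ P (fun i => [set x | (merged x.1 n).1 = i]) n.+1)//.
- by apply: eq_bigr => i _; rewrite counts_arrivals -ltnS ltn_ord.
- move=> i; rewrite counts_arrivals; case: ifP => _ //; exact: counts_measurable.
- by move=> x i j /= -> .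
- move=> x _; exists (merged x.1 n).1 => //.
  by rewrite ltnS; have := merged_sum x.1 n; lia.
Qed.

Lemma upto_measurable n : upto n `<=` measurable.
Proof.
move=> E GE.
rewrite (_ : E = \big[setU/set0]_(i < n.+1) (E `&` counts n i (n - i))).
  by apply: bigsetU_measurable => i _; apply: trace_measurable; exact: GE.
rewrite -(bigcup_mkord _ (fun i => E `&` counts n i (n - i))).
apply/seteqP; split => [x Ex|x [i _ []]//].
exists (merged x.1 n).1 => /=.
  by rewrite ltnS; have := merged_sum x.1 n; lia.
split => //; rewrite /counts /=; have := merged_sum x.1 n.
by case: merged => a b /= <-; rewrite addKn.
Qed.

Lemma upto_arrival n : upto n.+1 [set x | is_arrival n x.1].
Proof.
move=> i j; exists [set x | last_point 0 S j x < last_point 0 A i x].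
  apply: past_lt.
  - exact: past_measurable_lastS.
  - exact: past_measurable_lastA.
have e x : counts n.+1 i j x ->
    is_arrival n x.1 = (last_point 0 S j x < last_point 0 A i x).
  move=> c; rewrite last_point_arr last_point_svc.
  exact: (mergedS_arrival (input_gapA ^~ _) (input_gapS ^~ _) (input_neq _) c).
by apply/seteqP; split => x [h c]; split => //; move: h; rewrite /mkset e.
Qed.

(** Counts [(i, j)] after one more event come from one arrival less or one token less. The order of
    the last arrival and the last token tells which; this is a past event [L], and the two
    descriptions of [E] are glued along it. A predecessor with a negative count does not exist,
    whence [set0]. *)
Lemma uptoS n : upto n `<=` upto n.+1.
Proof.
move=> E GE i j.
have [Ea GEa Eaeq] : exists2 Ea, <<s past A S U i j >> Ea &
    forall x, counts n.+1 i j x -> is_arrival n x.1 -> E x = Ea x.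
  case: i => [|i].
    exists set0 => [|x]; first by have [] := smallest_sigma_algebra setT (past A S U 0 j).
    rewrite /counts /=; case e : (merged x.1 n) => [k l].
    by rewrite (is_arrivalE e); case: ifP.
  have [Ea GEa Eaeq] := GE i j; exists Ea; first exact: past_sub GEa.
  move=> x; rewrite /counts /=; case e : (merged x.1 n) => [k l].
  rewrite (is_arrivalE e); case: ifP => // _ [ki lj] _.
  rewrite ki lj in e.
  have : (E `&` counts n i j) x = (Ea `&` counts n i j) x by rewrite Eaeq.
  rewrite /counts /setI /mkset e /=; rewrite !propeqE; tauto.
have [Es GEs Eseq] : exists2 Es, <<s past A S U i j >> Es &
    forall x, counts n.+1 i j x -> ~~ is_arrival n x.1 -> E x = Es x.
  case: j {Ea GEa Eaeq} => [|j].
    exists set0 => [|x]; first by have [] := smallest_sigma_algebra setT (past A S U i 0).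
    rewrite /counts /=; case e : (merged x.1 n) => [k l].
    by rewrite (is_arrivalE e); case: ifP.
  have [Ea GEa Eaeq] := GE i j; exists Ea; first exact: past_sub GEa.
  move=> x; rewrite /counts /=; case e : (merged x.1 n) => [k l].
  rewrite (is_arrivalE e); case: ifP => // _ [ki lj] _.
  rewrite ki lj in e.
  have : (E `&` counts n i j) x = (Ea `&` counts n i j) x by rewrite Eaeq.
  rewrite /counts /setI /mkset e /=; rewrite !propeqE; tauto.
pose L := [set x | last_point 0 S j x < last_point 0 A i x].
have GL : <<s past A S U i j >> L.
  apply: past_lt.
  - exact: past_measurable_lastS.
  - exact: past_measurable_lastA.
exists ((Ea `&` L) `|` (Es `&` ~` L)).
  apply: (@measurableU _ (g_sigma_algebraType (past A S U i j))).
  - exact: past_setI.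
  - by apply: past_setI => //; apply: (@measurableC _ (g_sigma_algebraType (past A S U i j))).
rewrite setIUl; apply/seteqP; split => x.
- move=> [Ex c].
  have := mergedS_arrival (input_gapA ^~ _) (input_gapS ^~ _) (input_neq _) c.
  rewrite -last_point_arr -last_point_svc -/(L x) => eL.
  case: (boolP (is_arrival n x.1)) => ar.
    by left; split => //; split; [rewrite -Eaeq|rewrite /L /= -eL].
  by right; split => //; split; [rewrite -Eseq|rewrite /L /= -eL; apply/negP].
- case=> -[[Ex Lx] c]; split => //;
  have := mergedS_arrival (input_gapA ^~ _) (input_gapS ^~ _) (input_neq _) c;
  rewrite -last_point_arr -last_point_svc => eL.
    by rewrite Eaeq// eL.
  by rewrite Eseq// eL; apply/negP.
Qed.

Lemma arrival_measurable n : measurable [set x : Omega | is_arrival n x.1].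
Proof. exact: (upto_measurable (@upto_arrival n)). Qed.

Lemma service_measurable n : measurable [set x : Omega | ~~ is_arrival n x.1].
Proof.
rewrite (_ : [set _ | _] = ~` [set x : Omega | is_arrival n x.1]).
  by apply: measurableC; exact: arrival_measurable.
by apply/seteqP; split => x /= /negP.
Qed.

Lemma last_event_geA i j x : last_point 0 A i x <= last_event i j x.
Proof. by rewrite /last_event le_max lexx. Qed.

Lemma last_event_geS i j x : last_point 0 S j x <= last_event i j x.
Proof. by rewrite /last_event le_max lexx orbT. Qed.

(** On each value of the counts this is [service_first] at the time of the last event: the mark of
    the next event is independent of all that precedes it. *)
Lemma upto_service n E : upto n E ->
  P (E `&` [set x | ~~ is_arrival n x.1]) =
  ((mu / (lambda + mu))%:E * P E)%E.
Proof.
move=> GE; have mE := upto_measurable GE.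
rewrite (@counts_partition n); last first.
  by apply: measurableI => //; exact: service_measurable.
rewrite [in RHS](@counts_partition n)// ge0_sume_distrr; last first.
  by move=> i _; exact: measure_ge0.
apply: eq_bigr => i _; have [E' GE' E'E] := GE i (n - i)%N.
have ni : (i + (n - i) == n)%N by rewrite subnKC// -ltnS.
transitivity ((mu / (lambda + mu))%:E * P (E' `&`
    [set x | last_event i (n - i) x < S (n - i)%N x]%R `&`
    [set x | last_event i (n - i) x < A i x]%R))%E; last first.
  by rewrite E'E countsE ni setIA.
rewrite -(service_first cl GE' (@past_measurable_last_event _ _)); first last.
- by move=> w _; exact: last_event_geS.
- by move=> w _; exact: last_event_geA.
congr (P _); rewrite setIAC E'E.
apply/seteqP; split => x.
- move=> [[Ex c] ar]; move: (c); rewrite countsE ni => -[c1 c2].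
  split => //=; rewrite -(is_serviceE (input_neq _) c)//.
- move=> [[Ex c1] /= c2].
  have c : counts n i (n - i) x.
    rewrite countsE ni; split => //=; exact: (lt_trans c1 c2).
  by split => //=; rewrite (is_serviceE (input_neq _) c).
Qed.

End steps.

(** * Information available at a given time *)

Section history_trace.
Context (R : realType) (p lambda : R) (I : input R).
Hypothesis hI : admission_input p lambda I.
Hypotheses (lambda0 : 0 < lambda) (p1 : p < 1).
Variable pi : policy I.

Notation Omega := (ispace I * rspace pi)%type.
Notation A := (fun k (x : Omega) => arr k x.1).
Notation S := (fun k (x : Omega) => svc k x.1).
Notation U := (@randomization R I pi).
Notation P := (joint_prob pi).
Notation mu := (1 - p).
Notation gA := (input_gapA hI ^~ _).
Notation gS := (input_gapS hI ^~ _).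
Notation nAS := (input_neq hI _).

Let cl : clocks P lambda mu A S U := input_clocks hI lambda0 p1 pi.

Definition at_time t i j : set Omega :=
  ([set x | last_point 0 A i x <= t] `&` [set x | last_point 0 S j x <= t]) `&`
  ([set x | t < S j x] `&` [set x | t < A i x]).

(** A generator about point number [k] is a past event if this point is among those counted;
    otherwise it is empty on [at_time t i j], since the point comes after [t] and [s <= t]. *)
Lemma history_trace t i j E : @history _ _ pi t E ->
  trace_of (past A S U i j) (at_time t i j) E.
Proof.
move: E; apply: smallest_sub; first exact: trace_of_sigma_algebra.
have s0 : <<s past A S U i j >> set0.
  by have [] := smallest_sigma_algebra setT (past A S U i j).
move=> _ [[k [s [st ->]]]|[k [s [st ->]]]|[B [mB ->]]].
- have [ki|ik] := ltnP k i.
    exists [set x | arr k x.1 <= s] => //.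
    apply: sub_sigma_algebra; constructor 1; exists k, `]-oo, s]%classic.
    by split.
  exists set0 => //; rewrite set0I; apply/seteqP; split => x //= -[/= ks [_ [_ ti]]].
  have := le_lt_trans (le_trans (le_trans (arr_le gA ik) ks) st) ti.
  by rewrite ltxx.
- have [kj|jk] := ltnP k j.
    exists [set x | svc k x.1 <= s] => //.
    apply: sub_sigma_algebra; constructor 2; exists k, `]-oo, s]%classic.
    by split.
  exists set0 => //; rewrite set0I; apply/seteqP; split => x //= -[/= ks [_ [tj _]]].
  have := le_lt_trans (le_trans (le_trans (svc_le gS jk) ks) st) tj.
  by rewrite ltxx.
- exists [set x | B x.2] => //; apply: sub_sigma_algebra; constructor 3.
  by exists B.
Qed.

Lemma at_timeE t n i j : at_time t i j `&` [set x | (i + j = n)%N] =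
  [set x | last_point 0 (@Z _ I) n x.1 <= t < Z n x.1] `&` @counts _ _ pi n i j.
Proof.
apply/seteqP; split => x.
- rewrite /at_time /= last_point_arr last_point_svc => -[[[h1 h2] [h3 h4]] ijn].
  have c : merged x.1 n = (i, j).
    rewrite -ijn; apply: (interlace_merged gA gS nAS).
    + exact: (le_lt_trans h1 h3).
    + exact: (le_lt_trans h2 h4).
  by split => //; rewrite (last_ZE gA gS nAS c) /Z c/= ge_max h1 h2 lt_min h3 h4.
- move=> [/= + c]; rewrite (last_ZE gA gS nAS c) /Z c/= ge_max lt_min.
  move=> /andP[/andP[h1 h2] /andP[h3 h4]]; split; last first.
    by have := merged_sum x.1 n; rewrite c.
  by split; [split|split] => //=; rewrite ?last_point_arr ?last_point_svc.
Qed.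

Lemma history_measurable t : @history _ _ pi t `<=` measurable.
Proof.
apply: smallest_sub; first exact: sigma_algebra_measurable.
move=> _ [[k [s [st ->]]]|[k [s [st ->]]]|[B [mB ->]]].
- rewrite (_ : [set _ | _] = A k @^-1` `]-oo, s]).
    by rewrite -[X in measurable X]setTI; apply: (clock_mA cl).
  by apply/seteqP; split => x /=; rewrite in_itv.
- rewrite (_ : [set _ | _] = S k @^-1` `]-oo, s]).
    by rewrite -[X in measurable X]setTI; apply: (clock_mS cl).
  by apply/seteqP; split => x /=; rewrite in_itv.
- by apply: (clock_mU cl); exists B.
Qed.

Lemma at_time_run t i j m E : @history _ _ pi t E ->
  P (E `&` at_time t i j `&` [set x | S (j + m)%N x < A i x]) =
  (((mu / (lambda + mu)) ^+ m.+1)%:E * P (E `&` at_time t i j))%E.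
Proof.
move=> /(@history_trace t i j)[E' GE' ->].
pose F := E' `&` ([set x | last_point 0 A i x <= t] `&` [set x | last_point 0 S j x <= t]).
have GF : <<s past A S U i j >> F.
  have ht : measurable_fun setT ((fun=> t) : g_sigma_algebraType (past A S U i j) -> R).
    exact: measurable_cst.
  apply: past_setI => //; apply: past_setI.
  - apply: (@measurable_set_bool _ (g_sigma_algebraType (past A S U i j))).
    by apply: measurable_fun_ler => //; exact: past_measurable_lastA.
  - apply: (@measurable_set_bool _ (g_sigma_algebraType (past A S U i j))).
    by apply: measurable_fun_ler => //; exact: past_measurable_lastS.
have e : E' `&` at_time t i j = F `&` [set x | t < S j x] `&` [set x | t < A i x].
  by rewrite /at_time /F !setIA.
rewrite e -(services_run cl GF (measurable_cst t)).
- congr (P _); apply/seteqP; split => x; first by move=> [[Fx _] h]; split.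
  move=> [[Fx h1] h2]; split => //; split => //=.
  apply: (lt_trans h1); apply: le_lt_trans h2.
  apply: svc_le; [exact: gS|exact: leq_addr].
- by move=> w [_ []].
- by move=> w [_ []].
Qed.

(* Whatever happened up to time [t], the next [m.+1] events are services with
   probability [b ^+ m.+1]; [V] is any event forced by such a run. *)
Lemma history_run t N m (E V : set Omega) : 0 <= t ->
  @history _ _ pi t E -> measurable V ->
  (forall x, E x -> t < Z N x.1) ->
  (forall x i j, E x -> at_time t i j x -> svc (j + m) x.1 < arr i x.1 -> V x) ->
  (((mu / (lambda + mu)) ^+ m.+1)%:E * P E <= P (E `&` V))%E.
Proof.
move=> t0 HE mV EN EV.
have mE := history_measurable HE.
have mat i j : measurable (at_time t i j).
  apply: (past_measurable cl (i:=i.+1) (j:=j.+1)).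
  have ht : measurable_fun setT
      ((fun=> t) : g_sigma_algebraType (past A S U i.+1 j.+1) -> R).
    exact: measurable_cst.
  have mA := past_measurable_fun_sub (leqnSn i) (leqnSn j)
    (@past_measurable_lastA _ _ _ A S U i j).
  have mS := past_measurable_fun_sub (leqnSn i) (leqnSn j)
    (@past_measurable_lastS _ _ _ A S U i j).
  apply: past_setI; apply: past_setI.
  - apply: (@measurable_set_bool _ (g_sigma_algebraType (past A S U i.+1 j.+1))).
    exact: measurable_fun_ler.
  - apply: (@measurable_set_bool _ (g_sigma_algebraType (past A S U i.+1 j.+1))).
    exact: measurable_fun_ler.
  - by apply: past_lt => //; exact: past_measurableS.
  - by apply: past_lt => //; exact: past_measurableA.
(* [t] falls between two consecutive events. As [Z N] exceeds [t] on [E], only [n <= N] can occur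
   there and the sums below are finite. *)
pose F n := [set x : Omega | last_point 0 (@Z _ I) n x.1 <= t < Z n x.1].
have FE n i : (i <= n)%N -> F n `&` counts n i (n - i) = at_time t i (n - i).
  move=> ni; rewrite -at_timeE; apply/seteqP; split => [x []//|x ax].
  by split => //=; rewrite subnKC.
have mF n : measurable (F n).
  rewrite (_ : F n = \big[setU/set0]_(i < n.+1) at_time t i (n - i)).
    exact: bigsetU_measurable.
  rewrite -(bigcup_mkord _ (fun i => at_time t i (n - i))).
  apply/seteqP; split => [x Fx|x [i /= ni]].
    have := merged_sum x.1 n => ms; exists (merged x.1 n).1 => /=; first by lia.
    rewrite -FE; last by lia.
    split => //; rewrite /counts /=; move: ms; case: merged => a b /= <-.
    by rewrite addKn.
  by rewrite -FE// => -[].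
have part (G : set Omega) : measurable G -> G `<=` E ->
    P G = (\sum_(n < N.+1) \sum_(i < n.+1) P (G `&` at_time t i (n - i)))%E.
  move=> mG GE; rewrite (@prob_partition _ _ _ P F N.+1)//.
  - apply: eq_bigr => n _; rewrite (@counts_partition _ _ _ _ hI lambda0 p1 _ n).
      by apply: eq_bigr => i _; rewrite -setIA FE// -ltnS.
    exact: measurableI.
  - move=> x k l /= /andP[h1 h2] /andP[h3 h4].
    have [kl|lk|//] := ltngtP k l.
    + case: l kl h3 {h4} => // l; rewrite ltnS /= => kl h3.
      by have := lt_le_trans h2 (le_trans (Z_le gA gS nAS kl) h3); rewrite ltxx.
    + case: k lk h1 {h2} => // k; rewrite ltnS /= => lk h1.
      by have := lt_le_trans h4 (le_trans (Z_le gA gS nAS lk) h1); rewrite ltxx.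
  - move=> x /GE/EN tN.
    have exn : exists n, t < Z n x.1 by exists N.
    case: (ex_minnP exn) => n tn nmin; exists n; first by rewrite ltnS nmin.
    rewrite /F /= tn andbT; case: n {tn} nmin => [|n] nmin //=.
    by rewrite leNgt; apply/negP => /nmin; rewrite ltnn.
rewrite part// [leRHS]part//; last exact: measurableI.
rewrite ge0_sume_distrr; last by move=> n _; apply: sume_ge0.
apply: lee_sum => n _; rewrite ge0_sume_distrr//.
apply: lee_sum => i _; rewrite -at_time_run//.
apply: le_measure.
- rewrite inE; apply: measurableI; first exact: measurableI.
  by apply: measurable_set_lt; [exact: (clock_mS cl)|exact: (clock_mA cl)].
- by rewrite inE; apply: measurableI => //; exact: measurableI.
- move=> x [[Ex Fx] h]; split => //; split => //; exact: EV h.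
Qed.

End history_trace.

(** * The queue as seen from a history *)

Section history_queue.
Context (R : realType) (p lambda : R) (I : input R).
Hypothesis hI : admission_input p lambda I.
Variable pi : policy I.

Notation Omega := (ispace I * rspace pi)%type.
Notation A := (fun k (x : Omega) => arr k x.1).
Notation S := (fun k (x : Omega) => svc k x.1).
Notation gA := (input_gapA hI ^~ _).
Notation gS := (input_gapS hI ^~ _).
Notation nAS := (input_neq hI _).
Notation hist := (@history _ _ pi).
Notation TH t := (g_sigma_algebraType (hist t)).

Lemma hist_sigma t : sigma_algebra setT (hist t).
Proof. exact: smallest_sigma_algebra. Qed.

Lemma histE t : <<s hist t >> = hist t.
Proof. exact/sigma_algebra_id/hist_sigma. Qed.

Lemma histI t E F : hist t E -> hist t F -> hist t (E `&` F).
Proof. by rewrite -histE; exact: (@measurableI _ (TH t)). Qed.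

Lemma histU t E F : hist t E -> hist t F -> hist t (E `|` F).
Proof. by rewrite -histE; exact: (@measurableU _ (TH t)). Qed.

Lemma histD t E F : hist t E -> hist t F -> hist t (E `\` F).
Proof. by rewrite -histE; exact: (@measurableD _ (TH t)). Qed.

Lemma hist_bigcup t (E : nat -> set Omega) :
  (forall i, hist t (E i)) -> hist t (\bigcup_i E i).
Proof. by have [_ _] := hist_sigma t; exact. Qed.

Lemma hist0 t : hist t set0. Proof. by have [] := hist_sigma t. Qed.

(** As for a stopping time, but restricted to [r <= t]: later values are not seen at time [t]. *)
Definition observable t (f : Omega -> R) := forall r, r <= t -> hist t [set x | f x <= r].

Lemma observable_lt t s f g : s <= t -> observable t f -> observable t g ->
  hist t ([set x | f x <= s] `&` [set x | f x < g x]).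
Proof.
move=> st of_ og.
(* Only the part of a clock before [s] is observed, so that [f] and [g] are
   compared after truncation at [s]. *)
pose trunc (h : Omega -> R) x := if h x <= s then h x else s + 1.
have mtrunc h : observable t h -> measurable_fun setT (trunc h : TH t -> R).
  move=> oh; apply: (measurability _ (RGenOInfty.measurableE R)) => //.
  move=> _ [_ [r ->] <-]; rewrite setTI.
  have [sr|rs] := leP s r.
    have [s1r|rs1] := leP (s + 1) r.
      rewrite (_ : _ @^-1` _ = set0).
        exact: measurable0.
      apply/seteqP; split => x //=; rewrite in_itv /= andbT /trunc.
      by case: ifP => h1 h2; have := lt_le_trans h2 _; lra.
    rewrite (_ : _ @^-1` _ = ~` [set x | h x <= s]).
      by apply: (@measurableC _ (TH t)); apply: sub_sigma_algebra; exact: oh.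
    apply/seteqP; split => x /=; rewrite in_itv /= andbT /trunc; case: ifP => //; lra.
  rewrite (_ : _ @^-1` _ = ~` [set x | h x <= r]).
    apply: (@measurableC _ (TH t)); apply: sub_sigma_algebra; apply: oh; lra.
  apply/seteqP; split => x /=; rewrite in_itv /= andbT /trunc; case: ifP => //; lra.
rewrite (_ : _ `&` _ = [set x | f x <= s] `&` [set x | trunc f x < trunc g x]).
  apply: histI; first exact: of_.
  rewrite -histE; apply: (@measurable_set_lt _ (TH t)); exact: mtrunc.
apply/seteqP; split => x /= [fs]; rewrite /trunc fs; case: ifP => //; lra.
Qed.

Lemma observable_arr t k : observable t (A k).
Proof. by move=> r rt; apply: sub_sigma_algebra; constructor 1; exists k, r. Qed.

Lemma observable_svc t k : observable t (S k).
Proof. by move=> r rt; apply: sub_sigma_algebra; constructor 2; exists k, r. Qed.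

Lemma histT t : hist t setT.
Proof. rewrite -histE; exact: (@measurableT _ (TH t)). Qed.

Lemma observable_cst t (c : R) : observable t (fun=> c).
Proof.
move=> r _ /=; have [r0|r0] := boolP (c <= r).
  by rewrite (_ : [set _ | _] = setT); [exact: histT|apply/seteqP; split].
by rewrite (_ : [set _ | _] = set0); [exact: hist0|apply/seteqP; split].
Qed.

Lemma observable_lastA t k : observable t (last_point 0 A k).
Proof. by case: k => [|k]; [exact: observable_cst|exact: observable_arr]. Qed.

Lemma observable_lastS t k : observable t (last_point 0 S k).
Proof. by case: k => [|k]; [exact: observable_cst|exact: observable_svc]. Qed.

Definition by_time s n : set Omega := [set x | Z n x.1 <= s].

(** By interlacing, the counts amount to comparing last points with next points; once event [n] has
    occurred by [s], so have the last points, and these comparisons are observable. *)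
Lemma hist_counts s t n i j : s <= t -> hist t (@counts _ _ pi n i j `&` by_time s n).
Proof.
move=> st; have [ijn|ijn] := boolP (i + j == n)%N; last first.
  rewrite (_ : _ `&` _ = set0); first exact: hist0.
  apply/seteqP; split => x //= -[c _].
  by move: ijn; have := merged_sum x.1 n; rewrite c /= => ->; rewrite eqxx.
rewrite (_ : _ `&` _ =
  (([set x | last_point 0 A i x <= s] `&` [set x | last_point 0 A i x < S j x]) `&`
  ([set x | last_point 0 S j x <= s] `&` [set x | last_point 0 S j x < A i x])) `&`
  ([set x | A i x <= s] `|` [set x | S j x <= s])).
  apply: histI; first apply: histI.
  - by apply: observable_lt => //; [exact: observable_lastA|exact: observable_svc].
  - by apply: observable_lt => //; [exact: observable_lastS|exact: observable_arr].
  - by apply: histU; [exact: observable_arr|exact: observable_svc].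
rewrite /by_time; apply/seteqP; split => x.
- move=> [c /= zs]; have [h1 h2] := merged_interlace gA gS nAS c.
  have := last_Z_lt gA gS nAS n (w := x.1).
  rewrite (last_ZE gA gS nAS c) => /lt_le_trans/(_ zs); rewrite gt_max => /andP[g1 g2].
  rewrite last_point_arr last_point_svc; split; first by split; split => //=; exact: ltW.
  by move: zs; rewrite /Z c /= ge_min => /orP.
- move=> [[[h1 h2] [h3 h4]] /= h5]; move: h2 h4 => /=.
  rewrite last_point_arr last_point_svc => h2 h4.
  have c : merged x.1 n = (i, j).
    by rewrite -(eqP ijn); exact: (interlace_merged gA gS nAS).
  by split => //=; rewrite /Z c /= ge_min; apply/orP.
Qed.

Lemma by_timeE s n : by_time s n = \bigcup_i (counts n i (n - i) `&` by_time s n).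
Proof.
apply/seteqP; split => [x xs|x [i _ []]//].
exists (merged x.1 n).1 => //; split => //; rewrite /counts /=.
by have := merged_sum x.1 n; case: merged => a b /= <-; rewrite addKn.
Qed.

Lemma hist_by_time s t n : s <= t -> hist t (by_time s n).
Proof. by move=> st; rewrite by_timeE; apply: hist_bigcup => i; exact: hist_counts. Qed.

Lemma hist_arrival s t n : s <= t ->
  hist t (by_time s n `&` [set x | is_arrival n x.1]).
Proof.
move=> st; rewrite by_timeE setI_bigcupl; apply: hist_bigcup => i.
rewrite (_ : _ `&` _ = (counts n i (n - i) `&` by_time s n) `&`
  ([set x | A i x <= s] `&` [set x | A i x < S (n - i)%N x])).
  apply: histI; first exact: hist_counts.
  by apply: observable_lt => //; [exact: observable_arr|exact: observable_svc].
apply/seteqP; split => x [[c zs] h]; split => //.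
- move: h; rewrite /mkset (is_arrivalE c) => h; split => //=.
  by move: zs; rewrite /by_time /Z /= c /= ge_min => /orP[//|/(le_trans (ltW h))].
- by rewrite /mkset (is_arrivalE c); case: h.
Qed.

(** Meant for [s = t - W]: decisions made by time [s] are known at [t], and the queue is computed
    from them and the marks, one event at a time. *)
Lemma hist_queue s t q0 n q : s <= t ->
  (forall m, (m < n)%N -> hist t (by_time s m `&` [set x | diverts m x])) ->
  hist t (by_time s n `&` [set x | queue_after q0 n x = q]).
Proof.
move=> st; elim: n q => [|n IH] q hd.
  have [->|qq] := eqVneq q q0.
    rewrite (_ : _ `&` _ = by_time s 0); first exact: hist_by_time.
    by apply/seteqP; split => [x []//|x ?]; split.
  rewrite (_ : _ `&` _ = set0); first exact: hist0.
  by apply/seteqP; split => x //= -[_ /esym/eqP]; rewrite (negbTE qq).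
pose ar := by_time s n `&` [set x | is_arrival n x.1].
pose dv := by_time s n `&` [set x | diverts n x].
have har : hist t ar by exact: hist_arrival.
have hdv : hist t dv by exact: hd.
have hB := @hist_by_time s t n st.
pose nx r (a b : bool) := if a then if b then r else r.+1 else r.-1.
pose sel (b : bool) (E : set Omega) := if b then E else by_time s n `\` E.
have hsel b E : hist t E -> hist t (sel b E).
  by move=> hE; case: b => //=; exact: histD.
pose part r a b : set Omega := if nx r a b == q then
   (by_time s n `&` [set x | queue_after q0 n x = r]) `&` (sel a ar `&` sel b dv)
   else set0.
have hpart r a b : hist t (part r a b).
  rewrite /part; case: ifP => _; last exact: hist0.
  apply: histI; first by apply: IH => m mn; apply: hd; exact: ltnW.
  by apply: histI; exact: hsel.
rewrite (_ : _ `&` _ = by_time s n.+1 `&`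
  \bigcup_r ((part r true true `|` part r true false) `|`
             (part r false true `|` part r false false))).
  apply: histI; first exact: hist_by_time.
  by apply: hist_bigcup => r; apply: histU; apply: histU.
have zz x : by_time s n.+1 x -> by_time s n x.
  by rewrite /by_time /=; apply: le_trans; exact/ltW/(Z_lt gA gS nAS).
apply/seteqP; split => x.
- move=> [zx qx]; split => //; exists (queue_after q0 n x) => //.
  have zn := zz _ zx.
  have xp : part (queue_after q0 n x) (is_arrival n x.1) (diverts n x) x.
    rewrite /part ifT; last first.
      by rewrite -qx /= /nx /H; case: (is_arrival n x.1); case: (diverts n x).
    split => //; split; rewrite /sel.
    + by case: ifPn => a; [split|split => // -[_ /=]; apply/negP].
    + by case: ifPn => a; [split|split => // -[_ /=]; apply/negP].
  by move: xp; case: (is_arrival n x.1); case: (diverts n x) => xp;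
    [left;left|left;right|right;left|right;right].
- move=> [zx [r _ hx]]; split => //.
  have zn := zz _ zx.
  have key a b : part r a b x -> queue_after q0 n.+1 x = q.
    rewrite /part; case: eqP => // <- [[_ qr] [sa sb]] /=.
    have -> : is_arrival n x.1 = a.
      case: a sa => /= [[]//|[_ sa]]; apply/negbTE/negP => h; apply: sa; by split.
    rewrite /H qr /nx; case: a sa => //= -[_ ->] /=.
    by case: b sb => [[_ ->]//|[_ sb]]; case: ifPn => // h; case: sb; split.
  by case: hx => -[]; exact: key.
Qed.

End history_queue.

(** * Waiting times of the superposition *)

Section gap_tail.
Context (R : realType) (p lambda : R) (I : input R).
Hypothesis hI : admission_input p lambda I.
Hypotheses (lambda0 : 0 < lambda) (p1 : p < 1).
Variable pi : policy I.

Notation Omega := (ispace I * rspace pi)%type.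
Notation A := (fun k (x : Omega) => arr k x.1).
Notation S := (fun k (x : Omega) => svc k x.1).
Notation U := (@randomization R I pi).
Notation P := (joint_prob pi).
Notation mu := (1 - p).
Notation gA := (input_gapA hI ^~ _).
Notation gS := (input_gapS hI ^~ _).
Notation nAS := (input_neq hI _).

Let cl : clocks P lambda mu A S U := input_clocks hI lambda0 p1 pi.

Definition long_wait n s : set Omega :=
  [set x | last_point 0 (@Z _ I) n x.1 + s < Z n x.1].

Lemma Z_measurable n : measurable_fun setT (fun x : Omega => Z n x.1).
Proof.
apply: (measurability _ (RGenOInfty.measurableE R)) => // _ [_ [r ->] <-].
rewrite setTI (_ : _ @^-1` _ = ~` @by_time _ _ pi r n).
  apply: measurableC; apply: (history_measurable hI lambda0 p1 (t := r)).
  exact: (hist_by_time hI).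
by apply/seteqP; split => x /=; rewrite in_itv /= andbT /by_time /= ltNge => /negP.
Qed.

Lemma long_wait_measurable n s : measurable (long_wait n s).
Proof.
apply: measurable_set_lt; last exact: Z_measurable.
apply: measurable_funD; last exact: measurable_cst.
by case: n => [|n]; [exact: measurable_cst|exact: Z_measurable].
Qed.

(** The superposition has rate [lambda + mu]: on each value of the counts, compare [wait_both] at
    the last event and at a time [s] later, when both ages have grown by [s]. *)
Lemma long_wait_prob n s : 0 <= s -> P (long_wait n s) = (expR (- (lambda + mu) * s))%:E.
Proof.
move=> s0; rewrite (counts_partition hI lambda0 p1 n); last exact: long_wait_measurable.
transitivity (\sum_(i < n.+1) (expR (- (lambda + mu) * s))%:E *
  P (setT `&` @counts _ _ pi n i (n - i)))%E; last first.
  rewrite -ge0_sume_distrr; last by move=> i _; exact: measure_ge0.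
  by rewrite -(counts_partition hI lambda0 p1)// probability_setT mule1.
apply: eq_bigr => i _.
have ni : (i + (n - i) == n)%N by rewrite subnKC// -ltnS.
have GT : <<s past A S U i (n - i) >> setT.
  exact: (@measurableT _ (g_sigma_algebraType (past A S U i (n - i)))).
have mt := @past_measurable_last_event _ I pi i (n - i).
have mts : measurable_fun setT
    (last_event i (n - i) \+ cst s : g_sigma_algebraType (past A S U i (n - i)) -> R).
  exact: measurable_funD.
have gtA w : last_point 0 A i w <= (last_event i (n - i) \+ cst s) w.
  by rewrite /= (le_trans (last_event_geA _ (n - i) _))// lerDl.
have gtS w : last_point 0 S (n - i) w <= (last_event i (n - i) \+ cst s) w.
  by rewrite /= (le_trans (last_event_geS i _ _))// lerDl.
rewrite (countsE hI) ni !setIA.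
rewrite (wait_both cl GT mt); last 2 first.
- by move=> w _; exact: last_event_geA.
- by move=> w _; exact: last_event_geS.
transitivity (P (setT `&` [set x | (last_event i (n - i) \+ cst s) x < S (n - i)%N x]
   `&` [set x | (last_event i (n - i) \+ cst s) x < A i x])).
  congr (P _); rewrite setTI.
  have cx x : last_event i (n - i) x < S (n - i)%N x -> last_event i (n - i) x < A i x ->
      long_wait n s x <-> last_event i (n - i) x + s < S (n - i)%N x /\
      last_event i (n - i) x + s < A i x.
    move=> h1 h2; have c : counts n i (n - i) x by rewrite (countsE hI) ni.
    rewrite /long_wait /= (last_ZE gA gS nAS c) /Z c /= -last_point_arr -last_point_svc lt_min.
    by split => [/andP[]|[-> ->]].
  apply/seteqP; split => x.
    by move=> [[lx h1] h2]; have [+ _] := cx _ h1 h2; case/(_ lx) => g1 g2; split.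
  move=> [/= h1 h2].
  have h1' : last_event i (n - i) x < S (n - i)%N x by apply: le_lt_trans h1; rewrite lerDl.
  have h2' : last_event i (n - i) x < A i x by apply: le_lt_trans h2; rewrite lerDl.
  by split => //; split => //; apply/cx.
rewrite (wait_both cl GT mts)//.
rewrite -ge0_integralZl//=; last first.
- apply/measurable_EFinP; apply: measurableT_comp => //.
  have mT (f : Omega -> R) :
      measurable_fun setT (f : g_sigma_algebraType (past A S U i (n - i)) -> R) ->
      measurable_fun setT f.
    by move=> mf _ B mB; apply: (past_measurable cl); exact: mf.
  have ml := mT _ mt.
  have mlA := mT _ (@past_measurable_lastA _ _ _ A S U i (n - i)).
  have mlS := mT _ (@past_measurable_lastS _ _ _ A S U i (n - i)).
  by apply: measurable_funB; apply: measurable_funM => //; exact: measurable_funB.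
apply: eq_integral => x _; rewrite -EFinM -expRD; congr (expR _)%:E; ring.
Qed.

End gap_tail.

(** * Drift balance *)

Section drift.
Context (R : realType).

(** Otherwise the second half of the sum alone exceeds the bound. It provides an end point for the
    balance where the mean queue is under control. *)
Lemma exists_le_twice_average (e : nat -> R) (kappa : R) (N : nat) :
  (0 < N)%N -> (forall n, 0 <= e n) ->
  \sum_(n < N + N) e n <= kappa * (N + N)%:R ->
  exists n, (N <= n)%N /\ e n <= 2 * kappa.
Proof.
case: N => // N _ e0 avg; apply: contrapT => H.
have {}H n : 2 * kappa < e (N.+1 + n)%N.
  by rewrite ltNge; apply/negP => h; apply: H; exists (N.+1 + n)%N; rewrite leq_addr.
have : 2 * kappa *+ N.+1 < \sum_(n < N.+1) e (N.+1 + n)%N.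
  rewrite big_ord_recr /= mulrSr; apply: ler_ltD => //.
  rewrite -[X in _ *+ X]card_ord -sumr_const; apply: ler_sum => i _.
  exact/ltW.
rewrite ltNge => /negP; apply.
have : 0 <= \sum_(n < N.+1) e n by apply: sumr_ge0.
move: avg; rewrite big_split_ord /= natrD -mulr_natr; lra.
Qed.

(** Each [w m] lies in at most [M] windows. *)
Lemma sum_window (w : nat -> R) (N M : nat) : (forall n, 0 <= w n) ->
  \sum_(n < N) \sum_(k < M) w (n + k)%N <= M%:R * \sum_(m < N + M) w m.
Proof.
move=> w0; rewrite exchange_big /= mulr_natl -[X in _ *+ X]card_ord -sumr_const.
apply: ler_sum => k _.
rewrite -(big_mkord xpredT w) (@big_cat_nat _ _ _ k)//=; last first.
  by rewrite (leq_trans (ltnW (ltn_ord k)))// leq_addl.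
rewrite -[leLHS]add0r; apply: lerD; first exact: sumr_ge0.
rewrite (@big_cat_nat _ _ _ (N + k))//=; last 2 first.
- exact: leq_addl.
- by rewrite leq_add2l ltnW.
rewrite -[leLHS]addr0; apply: lerD; last exact: sumr_ge0.
have -> : \sum_(k <= i < N + k) w i = \sum_(i < N) w (i + k)%N.
  by rewrite -{1}[k : nat]add0n big_addn addnK big_mkord.
exact: lexx.
Qed.

(* At event [n], [e n] is the mean queue length, and [h n] and [w n] are the
   probabilities of a diversion and of a wasted service token. *)
Lemma drift_bound (e h w : nat -> R) (a b kappa B c delta : R) (M : nat) :
  (forall n, 0 <= e n) -> (forall n, 0 <= w n) ->
  (forall n, e n.+1 = e n + a - b - h n + w n) ->
  0 <= B -> 0 <= c -> c * kappa <= 4^-1 ->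
  (forall n, B * (3 / 4 - c * e n) <= \sum_(k < M) w (n + k)%N) ->
  (\forall N \near \oo, \sum_(n < N) e n <= kappa * N%:R) ->
  (\forall N \near \oo, \sum_(n < N) h n <= (a - b + delta) * N%:R) ->
  B / 2 <= M%:R * delta.
Proof.
move=> e0 w0 step B0 c0 ck loc [N0 _ avg] [N1 _ feas].
have {}avg N : (N0 <= N)%N -> \sum_(n < N) e n <= kappa * N%:R by exact: avg.
have {}feas N : (N1 <= N)%N -> \sum_(n < N) h n <= (a - b + delta) * N%:R.
  by exact: feas.
rewrite leNgt; apply/negP => g0.
set g := B / 2 - M%:R * delta.
have {}g0 : 0 < g by rewrite subr_gt0.
have kappa0 : 0 <= kappa.
  have := avg N0.+1 (leqnSn _).
  have s0 : 0 <= \sum_(n < N0.+1) e n by exact: sumr_ge0.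
  move=> /(le_trans s0); rewrite pmulr_lge0//.
(* Beyond [X] the boundary terms [2 * kappa * M] and [B * M / 2], which do not grow with [n], are
   together less than [g * n]. *)
pose X := (2 * kappa * M%:R + B * M%:R / 2) / g.
pose N2 := (N0 + N1 + M + (Num.truncn X).+1)%N.
have N2X : X < N2%:R.
  have X0 : 0 <= X by rewrite divr_ge0 ?(ltW g0)// addr_ge0// ?divr_ge0 ?mulr_ge0.
  apply: lt_le_trans (truncnS_gt X) _; rewrite ler_nat; exact: leq_addl.
have N2gt0 : (0 < N2)%N by rewrite /N2 addnS.
have [N02 N12 M2] : [/\ (N0 + M <= N2)%N, (N1 <= N2)%N & (M <= N2)%N].
  by rewrite /N2; split; lia.
have [n [nN en]] := exists_le_twice_average N2gt0 e0
  (avg (N2 + N2)%N (leq_trans (leq_trans (leq_addr M N0) N02) (leq_addr _ _))).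
(* Summing the balance, the total waste is the change of the mean queue plus the diversions minus
   the drift, and diversions exceed the drift by at most [delta] per event. *)
have sw : \sum_(m < n) w m <= 2 * kappa + delta * n%:R.
  have tele k : \sum_(m < k) w m = e k - e 0%N - (a - b) * k%:R + \sum_(m < k) h m.
    elim: k => [|k IH]; first by rewrite !big_ord0; ring.
    by rewrite !big_ord_recr /= IH step -natr1; ring.
  have := feas n (leq_trans N12 nN).
  rewrite tele; move: (e0 0%N) en; lra.
pose N := (n - M)%N.
have nE : (N + M = n)%N by rewrite /N subnK// (leq_trans M2).
have : \sum_(k < N) B * (3 / 4 - c * e k) <= M%:R * (2 * kappa + delta * n%:R).
  apply: le_trans (_ : _ <= \sum_(k < N) \sum_(l < M) w (k + l)%N) _.
    by apply: ler_sum => k _; exact: loc.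
  apply: (le_trans (sum_window _ _ w0)).
  by rewrite nE ler_wpM2l.
have avgN : \sum_(k < N) e k <= kappa * N%:R.
  by apply: avg; rewrite /N leq_subRL ?(leq_trans M2)// addnC (leq_trans N02).
rewrite -mulr_sumr sumrB sumr_const card_ord -mulr_sumr -mulr_natr.
(* Taken off from 3/4, this leaves [B / 2] of waste per window on average. *)
have : c * \sum_(k < N) e k <= 4^-1 * N%:R.
  apply: (le_trans (ler_wpM2l c0 avgN)); rewrite mulrA.
  by rewrite ler_wpM2r.
move=> h1 h2.
have h3 : B * (N%:R / 2) <= M%:R * (2 * kappa + delta * n%:R).
  apply: le_trans h2; apply: ler_wpM2l => //; lra.
have nR : n%:R = N%:R + M%:R :> R by rewrite -natrD nE.
have : X * g < n%:R * g.
  by rewrite ltr_pM2r// (lt_le_trans N2X)// ler_nat.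
rewrite /X divfK ?gt_eqF// /g; move: h3; rewrite nR.
nra.
Qed.

End drift.

(** * Expectations of bounded variables *)

Section bounded_expectation.
Context d (T : measurableType d) (R : realType) (P : probability T R).
Implicit Types f g : T -> R.

(** After [n] events the queue is at most [q0 + n], so every expectation needed is finite and can be
    computed in [R]. *)
Definition bounded_measurable f :=
  measurable_fun setT f /\ exists M, forall x, `|f x| <= M.

Definition mean f : R := \int[P]_x f x.

Lemma bm_integrable f : bounded_measurable f -> P.-integrable setT (EFin \o f).
Proof.
move=> [mf [M fM]]; apply: measurable_bounded_integrable => //.
  by rewrite (le_lt_trans (probability_le1 P measurableT)) ?ltry.
exists M; split; first exact: num_real.
by move=> N MN x _; exact: (le_trans (fM x) (ltW MN)).
Qed.

Lemma bmD f g : bounded_measurable f -> bounded_measurable g ->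
  bounded_measurable (fun x => f x + g x).
Proof.
move=> [mf [M fM]] [mg [N gN]]; split; first exact: measurable_funD.
by exists (M + N) => x; rewrite (le_trans (ler_normD _ _))// lerD.
Qed.

Lemma bmM f g : bounded_measurable f -> bounded_measurable g ->
  bounded_measurable (fun x => f x * g x).
Proof.
move=> [mf [M fM]] [mg [N gN]]; split; first exact: measurable_funM.
by exists (M * N) => x; rewrite normrM ler_pM.
Qed.

Lemma bm_cst c : bounded_measurable (fun=> c).
Proof. by split; [exact: measurable_cst|exists `|c|]. Qed.

Lemma bmN f : bounded_measurable f -> bounded_measurable (fun x => - f x).
Proof.
by move=> [mf [M fM]]; split; [exact: measurable_funN|exists M => x; rewrite normrN].
Qed.

Lemma bmZ c f : bounded_measurable f -> bounded_measurable (fun x => c * f x).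
Proof. by apply: bmM; exact: bm_cst. Qed.

Lemma bm_bool (b : T -> bool) : measurable [set x | b x] ->
  bounded_measurable (fun x => (b x)%:R).
Proof.
move=> mb; split; last by exists 1 => x; case: (b x); rewrite ?normr1 ?normr0.
rewrite (_ : (fun _ => _) = \1_[set x | b x]); first exact: measurable_indic.
by apply/funext => x; rewrite indicE; congr ((nat_of_bool _)%:R); apply/idP/idP; rewrite inE.
Qed.

Lemma bm_sum (I : Type) (r : seq I) (F : I -> T -> R) :
  (forall i, bounded_measurable (F i)) ->
  bounded_measurable (fun x => \sum_(i <- r) F i x).
Proof.
move=> bF; elim: r => [|i r IH].
  rewrite (_ : (fun _ => _) = fun=> 0); first exact: bm_cst.
  by apply/funext => x; rewrite big_nil.
rewrite (_ : (fun _ => _) = fun x => F i x + \sum_(j <- r) F j x).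
  exact: bmD.
by apply/funext => x; rewrite big_cons.
Qed.

(** With finitely many values, the composite is a finite combination of indicators, whatever [g]
    is. *)
Lemma bm_nat (f : T -> nat) (N : nat) :
  (forall n, measurable [set x | f x = n]) -> (forall x, (f x <= N)%N) ->
  forall g : nat -> R, bounded_measurable (fun x => g (f x)).
Proof.
move=> mf fN g.
have b n : bounded_measurable (fun x => g n * (f x == n)%:R).
  apply: bmZ; apply: bm_bool.
  by rewrite (_ : [set _ | _] = [set x | f x = n])//; apply/seteqP; split => x /= /eqP.
rewrite (_ : (fun _ => _) = fun x => \sum_(n <- iota 0 N.+1) g n * (f x == n)%:R).
  exact: bm_sum.
apply/funext => x.
have fx : f x \in iota 0 N.+1 by rewrite mem_iota add0n ltnS leq0n fN.
rewrite [RHS](bigD1_seq (f x) fx (iota_uniq _ _)) [RHS]/=.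
by rewrite eqxx mulr1 big1 ?addr0// => n /negbTE; rewrite eq_sym => ->; rewrite mulr0.
Qed.

Lemma meanE f : bounded_measurable f -> (\int[P]_x (f x)%:E)%E = (mean f)%:E.
Proof.
by move=> /bm_integrable bf; rewrite /mean /Rintegral fineK// integrable_fin_num.
Qed.

Lemma meanD f g : bounded_measurable f -> bounded_measurable g ->
  mean (fun x => f x + g x) = mean f + mean g.
Proof. by move=> /bm_integrable bf /bm_integrable bg; exact: RintegralD. Qed.

Lemma meanZ c f : bounded_measurable f -> mean (fun x => c * f x) = c * mean f.
Proof. by move=> /bm_integrable bf; exact: RintegralZl. Qed.

Lemma meanN f : bounded_measurable f -> mean (fun x => - f x) = - mean f.
Proof.
move=> bf; rewrite -[RHS]mulN1r -meanZ//; congr mean.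
by apply/funext => x; rewrite mulN1r.
Qed.

Lemma mean_cst c : mean (fun=> c) = c.
Proof.
rewrite /mean Rintegral_cst//; set u := (X in fine X).
by have -> : u = 1%E; [exact: probability_setT|rewrite mulr1].
Qed.

Lemma mean_le f g : bounded_measurable f -> bounded_measurable g ->
  (forall x, f x <= g x) -> mean f <= mean g.
Proof. by move=> /bm_integrable bf /bm_integrable bg fg; exact: le_Rintegral. Qed.

Lemma mean_ge0 f : (forall x, 0 <= f x) -> 0 <= mean f.
Proof. by move=> f0; exact: Rintegral_ge0. Qed.

Lemma mean_sum (I : Type) (r : seq I) (F : I -> T -> R) :
  (forall i, bounded_measurable (F i)) ->
  mean (fun x => \sum_(i <- r) F i x) = \sum_(i <- r) mean (F i).
Proof.
move=> bF; elim: r => [|i r IH].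
  rewrite big_nil -[RHS]mean_cst; congr mean; apply/funext => x.
  by rewrite big_nil.
rewrite big_cons -IH -meanD//; last exact: bm_sum.
by congr mean; apply/funext => x; rewrite big_cons.
Qed.

Lemma mean_bool (b : T -> bool) : measurable [set x | b x] ->
  (mean (fun x => (b x)%:R))%:E = P [set x | b x].
Proof.
move=> mb; rewrite -meanE; last exact: bm_bool.
rewrite -[in RHS](setIT [set x | b x]) -integral_indic//; apply: eq_integral => x _.
by rewrite indicE; congr ((nat_of_bool _)%:R%:E); apply/idP/idP; rewrite inE.
Qed.

End bounded_expectation.

(** * Mean queue length and wasted tokens *)

Lemma queue_growth (R : realType) (I : input R) (pi : policy I) (q0 n l : nat)
    (x : ispace I * rspace pi) :
  (queue_after q0 (n + l) x <= queue_after q0 n x + l)%N.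
Proof.
elim: l => [|l IH]; first by rewrite !addn0.
by rewrite !addnS /=; case: ifP => _; [case: ifP => _|]; lia.
Qed.

Section queue_means.
Context (R : realType) (p lambda : R) (I : input R).
Hypothesis hI : admission_input p lambda I.
Hypotheses (lambda0 : 0 < lambda) (p1 : p < 1).
Variables (pi : policy I) (q0 : nat).
Hypothesis mdiv : forall n, measurable [set x | @diverts _ _ pi n x].

Notation Omega := (ispace I * rspace pi)%type.
Notation P := (joint_prob pi).
Notation mu := (1 - p).
Notation q := (@queue_after _ I pi q0).
Notation Ex := (mean P).

Let rt0 : lambda + mu != 0.
Proof. by rewrite gt_eqF// addr_gt0// subr_gt0. Qed.

Definition wasted n (x : Omega) : bool := ~~ is_arrival n x.1 && (q n x == 0)%N.

Lemma queue_measurable n k : measurable [set x | q n x = k].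
Proof.
elim: n k => [|n IH] k.
  have [->|kq] := eqVneq k q0.
    by rewrite (_ : [set _ | _] = setT)//; apply/seteqP; split.
  rewrite (_ : [set _ | _] = set0)//; apply/seteqP; split => x //= /esym/eqP.
  by rewrite (negbTE kq).
pose nx r (a b : bool) := if a then if b then r else r.+1 else r.-1.
have mar := arrival_measurable hI lambda0 p1 (pi := pi) n.
pose sel (b : bool) (F : set Omega) := if b then F else ~` F.
have msel b F : measurable F -> measurable (sel b F).
  by case: b => // mF; exact: measurableC.
pose part r a b : set Omega := if nx r a b == k then [set x | q n x = r] `&`
  (sel a [set x | is_arrival n x.1] `&` sel b [set x | diverts n x]) else set0.
have mpart r a b : measurable (part r a b).
  rewrite /part; case: ifP => // _; apply: measurableI => //.
  by apply: measurableI; exact: msel.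
rewrite (_ : [set _ | _] = \bigcup_r ((part r true true `|` part r true false) `|`
             (part r false true `|` part r false false))).
  by apply: bigcup_measurable => r _; do 2 apply: measurableU => //.
apply/seteqP; split => x.
- move=> qx; exists (q n x) => //.
  have xp : part (q n x) (is_arrival n x.1) (diverts n x) x.
    rewrite /part ifT; last first.
      by rewrite -qx /= /nx /H; case: (is_arrival n x.1); case: (diverts n x).
    by split => //; split; rewrite /sel; case: ifPn => // /negP.
  by move: xp; case: (is_arrival n x.1); case: (diverts n x) => xp;
    [left;left|left;right|right;left|right;right].
- move=> [r _ hx].
  have key a b : part r a b x -> q n.+1 x = k.
    rewrite /part; case: eqP => // <- [qr [sa sb]] /=.
    have -> : is_arrival n x.1 = a.
      by case: a sa => //= sa; apply/negbTE/negP.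
    have db : diverts n x = b.
      by case: b sb => //= sb; apply/negbTE/negP.
    by rewrite /H qr db /nx; case: a sa => //= ->.
  by case: hx => -[]; exact: key.
Qed.

Lemma bm_queue n (g : nat -> R) : bounded_measurable (fun x => g (q n x)).
Proof.
apply: (@bm_nat _ _ _ (q n) (q0 + n)); first exact: queue_measurable.
by move=> x; exact: (queue_growth q0 0 n x).
Qed.

Lemma H_measurable n : measurable [set x | @H _ I pi n x].
Proof.
rewrite (_ : [set _ | _] = [set x | is_arrival n x.1] `&` [set x | diverts n x]).
  by apply: measurableI => //; exact: (arrival_measurable hI lambda0 p1).
by apply/seteqP; split => x /= /andP.
Qed.

Lemma wasted_measurable n : measurable [set x | wasted n x].
Proof.
rewrite (_ : [set _ | _] = [set x | ~~ is_arrival n x.1] `&` [set x | q n x = 0%N]).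
  apply: measurableI; first exact: (service_measurable hI lambda0 p1).
  exact: queue_measurable.
apply/seteqP; split => x /=; first by move=> /andP[? /eqP].
by move=> [h1 h2]; rewrite /wasted h1 h2.
Qed.

Lemma mean_service n : Ex (fun x => (~~ is_arrival n x.1)%:R) = mu / (lambda + mu).
Proof.
apply: EFin_inj; rewrite mean_bool; last exact: (service_measurable hI lambda0 p1).
have GT : @upto R I pi n setT.
  by rewrite -(@upto_g R I pi n);
    exact: (@measurableT _ (g_sigma_algebraType (@upto R I pi n))).
have := upto_service hI lambda0 p1 GT.
by rewrite setTI => ->; rewrite probability_setT mule1.
Qed.

Lemma mean_arrival n : Ex (fun x => (is_arrival n x.1)%:R) = lambda / (lambda + mu).
Proof.
rewrite (_ : (fun _ => _) = fun x => 1 + - (~~ is_arrival n x.1)%:R); last first.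
  by apply/funext => x; case: is_arrival; rewrite ?oppr0 ?addr0 ?subrr.
have bs : bounded_measurable (fun x : Omega => (~~ is_arrival n x.1)%:R : R).
  by apply: bm_bool; exact: (service_measurable hI lambda0 p1).
rewrite meanD; [|exact: bm_cst|exact: bmN].
by rewrite mean_cst meanN// mean_service; field.
Qed.

(** The identity is pathwise: every token is subtracted, and a wasted one, having had no effect, is
    added back; likewise every arrival is added and a diverted one subtracted. *)
Lemma balance n : Ex (fun x => (q n.+1 x)%:R) =
  Ex (fun x => (q n x)%:R) + lambda / (lambda + mu) - mu / (lambda + mu)
    - Ex (fun x => (H n x)%:R) + Ex (fun x => (wasted n x)%:R).
Proof.
have bs : bounded_measurable (fun x : Omega => (~~ is_arrival n x.1)%:R : R).
  by apply: bm_bool; exact: (service_measurable hI lambda0 p1).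
have ba : bounded_measurable (fun x : Omega => (is_arrival n x.1)%:R : R).
  by apply: bm_bool; exact: (arrival_measurable hI lambda0 p1).
have bH := bm_bool R (@H_measurable n).
have bw := bm_bool R (@wasted_measurable n).
have bq := @bm_queue n (fun k => k%:R).
rewrite -(mean_arrival n) -(mean_service n) -!meanN//.
rewrite -!meanD//; do ?[exact: bmN|apply: bmD => //].
congr mean; apply/funext => x /=; rewrite /wasted.
rewrite /H; case: (is_arrival n x.1) => /=.
  case: (diverts n x) => /=; rewrite ?oppr0; last by rewrite -natr1; ring.
  by ring.
by case: (q n x) => [|k] /=; rewrite ?oppr0 -?natr1; ring.
Qed.

Lemma expect_diversions N : expect (fun x => \sum_(n < N) (@H _ I pi n x)%:R) =
  (\sum_(n < N) Ex (fun x => (H n x)%:R))%:E.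
Proof.
rewrite /expect [LHS](@meanE _ _ _ P)//; last first.
  by apply: bm_sum => n; apply: bm_bool; exact: H_measurable.
by rewrite mean_sum// => n; apply: bm_bool; exact: H_measurable.
Qed.

Lemma expect_queue N :
  expect (fun x => N%:R^-1 * \sum_(n < N) @Qleft _ I pi q0 (Z n x.1) x) =
  (N%:R^-1 * \sum_(n < N) Ex (fun x => (q n x)%:R))%:E.
Proof.
rewrite (_ : (fun _ => _) = fun x => N%:R^-1 * \sum_(n < N) (q n x)%:R); last first.
  apply/funext => -[w u]; congr (_ * _); apply: eq_bigr => n _.
  exact: (QleftE (input_gapA hI ^~ _) (input_gapS hI ^~ _) (input_neq hI _)).
have b n := @bm_queue n (fun k => k%:R).
rewrite /expect [LHS](@meanE _ _ _ P)//; last by apply: bmZ; exact: bm_sum.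
by rewrite meanZ ?mean_sum//; exact: bm_sum.
Qed.

End queue_means.

(** * Waste forced by a run of services *)

Section window.
Context (R : realType) (p lambda : R) (I : input R).
Hypothesis hI : admission_input p lambda I.
Variables (pi : policy I) (q0 : nat).

Notation Omega := (ispace I * rspace pi)%type.
Notation q := (@queue_after _ I pi q0).
Notation hist := (@history _ _ pi).
Notation gA := (input_gapA hI ^~ _).
Notation gS := (input_gapS hI ^~ _).
Notation nAS := (input_neq hI _).
Notation wasted := (@wasted R I pi q0).

(** Without waste, [m.+1] services would each take one from a queue of length at most [m]. *)
Lemma services_waste n m x : (q n x <= m)%N ->
  (forall l, (l <= m)%N -> ~~ is_arrival (n + l) x.1) ->
  exists2 l, (l <= m)%N & wasted (n + l) x.
Proof.
move=> qm sv; apply: contrapT => nw.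
have nw' l : (l <= m)%N -> (0 < q (n + l) x)%N.
  move=> lm; rewrite lt0n; apply/negP => q0'; apply: nw; exists l => //.
  by rewrite /wasted sv.
have key l : (l <= m.+1)%N -> (q (n + l) x + l = q n x)%N.
  elim: l => [|l IH] lm; first by rewrite !addn0.
  have := IH (ltnW lm); have := nw' l lm.
  by rewrite (addnS n) /= (negbTE (sv l lm)); lia.
have := key _ (leqnn _); lia.
Qed.

(** At most [L] events lie between the queue at event [n] and the queue at time [t], which is
    therefore at most [K + L <= m]; the [m.+1] services that follow exhaust it. *)
Lemma at_time_waste t i j m n K L x :
  Z n x.1 <= t < Z (n + L) x.1 -> (q n x <= K)%N -> (K + L <= m)%N ->
  at_time t i j x -> svc (j + m) x.1 < arr i x.1 ->
  exists2 k, (k < L + m.+1)%N & wasted (n + k) x.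
Proof.
move=> /andP[nt tL] qK KLm ax mA.
have [ct c] : ([set x | last_point 0 (@Z _ I) (i + j) x.1 <= t < Z (i + j) x.1] `&`
    @counts _ _ pi (i + j) i j) x.
  by rewrite -(at_timeE hI); split.
move: ct => /= /andP[zt tz].
have n_lt : (n < i + j)%N.
  rewrite ltnNge; apply/negP => h.
  by have := lt_le_trans tz (le_trans (Z_le gA gS nAS h) nt); rewrite ltxx.
have ij_le : (i + j <= n + L)%N.
  rewrite leqNgt; apply/negP; case: (i + j)%N zt => [//|s] /= zt h.
  by have := lt_le_trans tL (le_trans (Z_le gA gS nAS (h : (n + L <= s)%N)) zt); rewrite ltxx.
have [[a1 a2] [/= a3 a4]] := ax.
have sv l : (l <= m)%N -> ~~ is_arrival (i + j + l) x.1.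
  move=> lm.
  have cl : merged x.1 (i + (j + l)) = (i, (j + l)%N).
    apply: (interlace_merged gA gS nAS).
      rewrite -last_point_arr; apply: (le_lt_trans a1); apply: (lt_le_trans a3).
      by apply: (svc_le gS); exact: leq_addr.
    case: l lm => [|l] lm.
      by rewrite addn0 -last_point_svc; exact: (le_lt_trans a2).
    rewrite addnS /=; apply: le_lt_trans mA; apply: (svc_le gS).
    by rewrite leq_add2l ltnW.
  rewrite -addnA (is_serviceE nAS cl); apply: le_lt_trans mA; apply: (svc_le gS).
  by rewrite leq_add2l.
have qm : (q (i + j) x <= m)%N.
  have := queue_growth q0 n (i + j - n) x; rewrite (subnKC (ltnW n_lt)) => g.
  apply: (leq_trans g); apply: leq_trans KLm; apply: leq_add => //.
  by rewrite leq_subLR.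
have [l lm wl] := services_waste qm sv.
exists (i + j - n + l)%N; first by lia.
by rewrite addnA subnKC// ltnW.
Qed.

(** A long gap contributes 1/16 to an elapsed time that stays below [L / 32], so fewer than half of
    the gaps are long. *)
Lemma short_waits n L x (w : R) : (0 < L)%N -> w <= L%:R / 32 ->
  Z (n + L) x.1 < Z n x.1 + w ->
  L%:R / 2 <= \sum_(k < L) (~~ `[< @long_wait R I pi (n + k).+1 16^-1 x >])%:R :> R.
Proof.
move=> L0 wL zz.
pose s (k : nat) : R := (~~ `[< @long_wait R I pi (n + k).+1 16^-1 x >])%:R.
have tele l : Z n x.1 + \sum_(k < l) (1 - s k) / 16 <= Z (n + l) x.1.
  elim: l => [|l IH]; first by rewrite big_ord0 addr0 addn0.
  rewrite big_ord_recr /= addrA addnS; apply: le_trans (lerD IH (lexx _)) _.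
  rewrite /s; case: asboolP => /= [|_].
    by rewrite /long_wait /= subr0 mul1r => /ltW.
  by rewrite subrr mul0r addr0 ltW// (Z_lt gA gS nAS).
have := le_lt_trans (tele L) zz; rewrite ltrD2l -mulr_suml sumrB sumr_const card_ord.
rewrite -/(s _) => h.
have : L%:R - \sum_(k < L) s k < L%:R / 2.
  move: h; set a := \sum_(_ < _) _ => h; lra.
rewrite -/s; set a := \sum_(_ < _) _; lra.
Qed.

End window.

(** * Waste in spite of lookahead *)

Section lookahead.
Context (R : realType) (p lambda : R) (I : input R).
Hypothesis hI : admission_input p lambda I.
Hypotheses (lambda0 : 0 < lambda) (p1 : p < 1).
Variables (pi : policy I) (q0 : nat) (W : R).
Hypothesis hW : 0 <= W.
Hypothesis hpi : causal pi W.

Notation Omega := (ispace I * rspace pi)%type.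
Notation P := (joint_prob pi).
Notation mu := (1 - p).
Notation q := (@queue_after _ I pi q0).
Notation hist := (@history _ _ pi).
Notation gA := (input_gapA hI ^~ _).
Notation gS := (input_gapS hI ^~ _).
Notation nAS := (input_neq hI _).
Notation wasted := (@wasted R I pi q0).

Lemma causal_hist t m : hist t (by_time (t - W) m `&` [set x | diverts m x]).
Proof.
rewrite (_ : _ `&` _ = [set x | diverts m x /\ Z m x.1 + W <= t]); first exact: hpi.
by apply/seteqP; split => x; rewrite /by_time /setI /mkset lerBrDr => -[].
Qed.

Lemma causal_measurable m : measurable [set x | @diverts _ _ pi m x].
Proof.
rewrite (_ : [set _ | _] =
    \bigcup_(k : nat) (@by_time R I pi (k%:R - W) m `&` [set x : Omega | diverts m x])).
  apply: bigcup_measurable => k _.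
  by apply: (history_measurable hI lambda0 p1 (t := k%:R)); exact: causal_hist.
apply/seteqP; split => [x dx|x [k _ []]//].
exists (Num.truncn (Z m x.1 + W)).+1 => //; split => //.
by rewrite /by_time /= lerBrDr ltW// truncnS_gt.
Qed.

End lookahead.

Section lookahead.
Context (R : realType) (p lambda : R) (I : input R).
Hypothesis hI : admission_input p lambda I.
Hypotheses (lambda0 : 0 < lambda) (p1 : p < 1).
Variables (pi : policy I) (q0 : nat) (W : R).
Hypothesis hW : 0 <= W.
Hypothesis hpi : causal pi W.

Notation Omega := (ispace I * rspace pi)%type.
Notation P := (joint_prob pi).
Notation mu := (1 - p).
Notation q := (@queue_after _ I pi q0).
Notation hist := (@history _ _ pi).
Notation gA := (input_gapA hI ^~ _).
Notation gS := (input_gapS hI ^~ _).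
Notation nAS := (input_neq hI _).
Notation wasted := (@wasted R I pi q0).

(** On the event [g] below, the queue is at most [K] and the lookahead window, rounded up, closes
    before event [n + L]; a run of services then wastes a token with conditional probability at
    least [b ^+ m.+1]. By Markov's inequality the failure of [g] costs the mean queue over [K.+1],
    plus 1/4 for [L] events that come too quickly. *)
Lemma lookahead_waste n K L m : (K + L <= m)%N -> W + 1 <= L%:R / 32 ->
  lambda <= 1 -> 0 <= p ->
  (mu / (lambda + mu)) ^+ m.+1 *
    (3 / 4 - K.+1%:R^-1 * mean P (fun x => (q n x)%:R)) <=
  \sum_(k < L + m.+1) mean P (fun x => (wasted (n + k) x)%:R).
Proof.
move=> KLm WL l1 p0.
have L0 : (0 < L)%N.
  rewrite lt0n; apply/eqP => L0; move: WL hW; rewrite L0; lra.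
have mdiv := causal_measurable hI lambda0 p1 hpi.
have mq := @queue_measurable _ _ _ _ hI lambda0 p1 pi q0 mdiv.
have mw := @wasted_measurable _ _ _ _ hI lambda0 p1 pi q0 mdiv.
have bq := @bm_queue _ _ _ _ hI lambda0 p1 pi q0 mdiv.
have mlong k s := @long_wait_measurable _ _ _ _ hI lambda0 p1 pi k s.
pose b : R := mu / (lambda + mu).
have b0 : 0 <= b by apply: divr_ge0; [|apply: addr_ge0]; rewrite ltW// subr_gt0.
pose v x := [exists k : 'I_(L + m.+1), wasted (n + k) x].
have mV : measurable [set x | v x].
  rewrite (_ : [set _ | _] = \bigcup_(k in `I_(L + m.+1)) [set x | wasted (n + k) x]).
    by apply: bigcup_measurable => k _; exact: mw.
  apply/seteqP; split => [x /= /existsP[k kx]|x [k /= kL kx]]; first by exists k => /=.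
  by apply/existsP; exists (Ordinal kL).
have vle : mean P (fun x => (v x)%:R) <=
    \sum_(k < L + m.+1) mean P (fun x => (wasted (n + k) x)%:R).
  rewrite -mean_sum; last by move=> k; exact/bm_bool.
  apply: mean_le; [exact: bm_bool|by apply: bm_sum => k; exact: bm_bool|].
  move=> x; rewrite /v; case: existsP => [[k kx]|_]; last exact: sumr_ge0.
  by rewrite (bigD1 k)//= kx lerDl sumr_ge0.
apply: le_trans vle.
(* [k] is the first integer time at which all events seen by the decisions up
   to event [n] have occurred. *)
pose E (k : nat) := (by_time (k%:R - W) n `&` [set x | (q n x <= K)%N]) `\`
  (by_time (k%:R - 1 - W) n `|` by_time k%:R (n + L)).
have hE k : hist k%:R (E k).
  have sW : k%:R - W <= k%:R by rewrite gerBl.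
  apply: histD; last first.
    apply: histU; apply: (hist_by_time hI) => //.
    by rewrite -addrA gerDl; move: hW; lra.
  rewrite (_ : _ `&` _ = \bigcup_r (if (r <= K)%N then
      by_time (k%:R - W) n `&` [set x | q n x = r] else set0)).
    apply: hist_bigcup => r; case: ifP => _; last exact: hist0.
    by apply: (hist_queue hI) => // l _; exact: (causal_hist hpi).
  apply/seteqP; split => [x [xb xq]|x [r _]].
    by exists (q n x) => //; rewrite ifT.
  by case: ifP => // rK [xb qr]; split => //; rewrite /mkset qr.
have mE k := history_measurable hI lambda0 p1 (@hE k).
have tE k l x : E k x -> E l x -> k = l.
  have key k' l' : E k' x -> E l' x -> (l' <= k')%N.
    move=> [[+ _] _] [_ +]; rewrite /by_time /= => h1 /not_orP[/negP + _].
    rewrite -ltNge => h2; rewrite -ltnS -(ltr_nat R) -natr1; lra.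
  by move=> h1 h2; apply/eqP; rewrite eqn_leq !key.
have runE k : ((b ^+ m.+1)%:E * P (E k) <= P (E k `&` [set x | v x]))%E.
  apply: (history_run hI lambda0 p1 (t := k%:R) (N := n + L)) => //.
  - move=> x [_]; rewrite /by_time /= => /not_orP[_ /negP].
    by rewrite -ltNge.
  - move=> x i j [[nb nq] nn] ax mA.
    have [|l lL wl] := @at_time_waste _ _ _ _ hI pi q0 k%:R i j m n K L x _ nq KLm ax mA.
      move: nb nn; rewrite /by_time /= => nb /not_orP[_ /negP].
      rewrite -ltNge => ->; rewrite andbT (le_trans nb)// gerBl//.
    by apply/existsP; exists (Ordinal lL).
(* The unit added to [W] pays for rounding [Z n + W] up to the integer [k]. *)
pose g x := (q n x <= K)%N && (Z n x.1 + (W + 1) <= Z (n + L) x.1).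
have mZ k := @Z_measurable _ _ _ _ hI lambda0 p1 pi k.
have mG : measurable [set x | g x].
  rewrite (_ : [set _ | _] = (\bigcup_(r in `I_K.+1) [set x | q n x = r]) `&`
     [set x | Z n x.1 + (W + 1) <= Z (n + L) x.1]).
    apply: measurableI; first by apply: bigcup_measurable.
    apply: measurable_set_bool; apply: measurable_fun_ler => //.
    by apply: measurable_funD => //; exact: measurable_cst.
  apply/seteqP; split => [x /= /andP[h1 h2]|x [[r /= rK qr] h]].
    by split => //; exists (q n x).
  by rewrite /g qr -ltnS rK.
have GE : [set x | g x] `<=` \bigcup_k E k.
  move=> x /= /andP[qK ZL].
  have ex : exists k : nat, Z n x.1 + W <= k%:R.
    by exists (Num.truncn (Z n x.1 + W)).+1; rewrite ltW// truncnS_gt.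
  case: (ex_minnP ex) => k Zk kmin; exists k => //.
  have k1 : k%:R - 1 - W < Z n x.1.
    case: k {Zk} kmin => [|k] kmin.
      by have := Z_gt0 gA gS nAS n (w := x.1); move: hW; lra.
    rewrite -natr1 addrK ltrBlDr ltNge; apply/negP => /kmin.
    by rewrite ltnn.
  rewrite /E /by_time; split; first by split => //=; rewrite lerBrDr.
  move=> /= [|]; first by rewrite leNgt k1.
  by apply/negP; rewrite -ltNge; lra.
have Gv : b ^+ m.+1 * mean P (fun x => (g x)%:R) <= mean P (fun x => (v x)%:R).
  rewrite -lee_fin EFinM !mean_bool//.
  apply: (@le_trans _ _ ((b ^+ m.+1)%:E * P (\bigcup_k E k))%E).
    apply: lee_wpmul2l; first by rewrite lee_fin exprn_ge0.
    by apply: le_measure => //; rewrite inE//; exact: bigcup_measurable.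
  apply: (@le_trans _ _ (P (\bigcup_k (E k `&` [set x | v x])))); last first.
    apply: le_measure => //; rewrite ?inE//.
      by apply: bigcup_measurable => k _; exact: measurableI.
    by move=> x [k _ []].
  rewrite !measure_semi_bigcup//.
  - rewrite -nneseriesZl//; apply: lee_nneseries => [k _ _|k _]; last exact: runE.
    by rewrite mule_ge0// lee_fin exprn_ge0.
  - by move=> k; exact: measurableI.
  - by move=> k l _ _ [x [[xk _] [xl _]]]; exact: tE xk xl.
  - by apply: bigcup_measurable => k _; exact: measurableI.
  - by move=> k l _ _ [x [xk xl]]; exact: tE xk xl.
  - by apply: bigcup_measurable.
apply: le_trans Gv; apply: ler_wpM2l; first exact: exprn_ge0.
(* A gap is at most 1/16 with probability at most 1/8, so that by Markov's
   inequality more than half of the [L] gaps are that short with probability at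
   most 1/4. *)
pose sh (k : nat) (x : Omega) : bool := ~~ `[< @long_wait R I pi (n + k).+1 16^-1 x >].
have msh k : measurable [set x | sh k x].
  rewrite (_ : [set _ | _] = ~` @long_wait R I pi (n + k).+1 16^-1); first exact: measurableC.
  by apply/seteqP; split => x /= /asboolPn.
have shE k : mean P (fun x => (sh k x)%:R) <= 8^-1.
  have bs : bounded_measurable (fun x => (~~ sh k x)%:R : R).
    apply: bm_bool; rewrite (_ : [set _ | _] = @long_wait R I pi (n + k).+1 16^-1)//.
    by apply/seteqP; split => x; rewrite /sh /= negbK => /asboolP.
  rewrite (_ : (fun _ => _) = fun x => 1 + - (~~ sh k x)%:R); last first.
    by apply/funext => x; case: (sh k x); rewrite ?oppr0 ?addr0 ?subrr.
  rewrite meanD; [|exact: bm_cst|exact: bmN].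
  rewrite mean_cst meanN//.
  have -> : mean P (fun x => (~~ sh k x)%:R) = expR (- (lambda + mu) * 16^-1).
    apply: EFin_inj; rewrite mean_bool; last first.
      rewrite (_ : [set _ | _] = @long_wait R I pi (n + k).+1 16^-1)//.
      by apply/seteqP; split => x; rewrite /sh /= negbK => /asboolP.
    rewrite -(@long_wait_prob _ _ _ _ hI lambda0 p1 pi (n + k).+1)//.
    by congr (P _); apply/seteqP; split => x; rewrite /sh /= negbK => /asboolP.
  (* As [lambda + mu <= 2], the gap exceeds 1/16 with probability at least [1 - 2 / 16]. *)
  have := expR_ge1Dx (- (lambda + mu) * 16^-1); lra.
(* If [g] fails, either the queue exceeds [K] or at least half of the gaps are short; the
   corresponding subtracted term is then at least 1. *)
have pt x : 1 - K.+1%:R^-1 * (q n x)%:R -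
    (2 / L%:R) * \sum_(k < L) (sh k x)%:R <= (g x)%:R :> R.
  have L0' : L%:R != 0 :> R by rewrite pnatr_eq0 -lt0n.
  have c0 : 0 <= 2 / L%:R :> R by [].
  set u := K.+1%:R^-1 * _; set t := 2 / L%:R * _.
  have u0 : 0 <= u by rewrite mulr_ge0.
  have t0 : 0 <= t by apply: mulr_ge0 => //; exact: sumr_ge0.
  have [u1|u1] := leP 1 u; first by apply: (@le_trans _ _ 0) => //; lra.
  have [t1|t1] := leP 1 t; first by apply: (@le_trans _ _ 0) => //; lra.
  rewrite /g; case: leqP => qK /=; last first.
    by move: u1; rewrite ltNge /u mulrC ler_pdivlMr// mul1r ler_nat qK.
  case: (leP (Z n x.1 + (W + 1)) (Z (n + L) x.1)) => ZL; first by rewrite mulr1n; lra.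
  move: t1; rewrite ltNge => /negP; case; rewrite /t.
  have h := ler_wpM2l c0 (short_waits hI L0 WL ZL).
  apply: le_trans _ h; rewrite mulrA divfK// divff//.
have bg : bounded_measurable (fun x => (g x)%:R : R) by exact: bm_bool.
have bsh : bounded_measurable (fun x => \sum_(k < L) (sh k x)%:R : R).
  by apply: bm_sum => k; exact: bm_bool.
have bqn := bq n (fun k => k%:R).
apply: le_trans (_ : _ <= mean P (fun x => 1 - K.+1%:R^-1 * (q n x)%:R -
    (2 / L%:R) * \sum_(k < L) (sh k x)%:R)) _; last first.
  apply: mean_le => //; apply: bmD; last by apply: bmN; exact: bmZ.
  by apply: bmD; [exact: bm_cst|apply: bmN; exact: bmZ].
rewrite !meanD ?mean_cst ?meanN ?meanZ ?mean_sum//; last 7 first.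
- by move=> k; exact: bm_bool.
- exact: bmZ.
- exact: bmZ.
- exact: bm_cst.
- by apply: bmN; exact: bmZ.
- by apply: bmD; [exact: bm_cst|apply: bmN; exact: bmZ].
- by apply: bmN; exact: bmZ.
have : 2 / L%:R * \sum_(k < L) mean P (fun x => (sh k x)%:R) <= 4^-1.
  apply: (@le_trans _ _ (2 / L%:R * (L%:R * 8^-1))).
    apply: ler_wpM2l => //; rewrite mulr_natl -[X in _ *+ X]card_ord -sumr_const.
    by apply: ler_sum => k _; exact: shE.
  have : L%:R != 0 :> R by rewrite pnatr_eq0 -lt0n.
  by move=> ?; rewrite mulrA divfK//; lra.
set t := 2 / L%:R * _; set u := K.+1%:R^-1 * _; lra.
Qed.

End lookahead.

(** * Lower bound *)

Section limsup.
Context (R : realType).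
Implicit Types (u : nat -> \bar R) (l : \bar R).
Local Open Scope ereal_scope.

Lemma limn_esup_lt u l : limn_esup u < l -> \forall n \near \oo, u n < l.
Proof.
rewrite /limn_esup /limf_esup => /ereal_inf_lt[_ [V VF <-] Vl].
apply: filterS VF => n Vn; apply: le_lt_trans Vl; apply: ereal_sup_ubound.
by exists n.
Qed.

Lemma limn_esup_le u l : (\forall n \near \oo, u n <= l) -> limn_esup u <= l.
Proof.
move=> ul; rewrite /limn_esup /limf_esup.
apply: (@le_trans _ _ (ereal_sup (u @` [set n | u n <= l]))).
  by apply: ereal_inf_lbound; exists [set n | u n <= l].
by apply: ge_ereal_sup => _ [n un <-].
Qed.

Lemma limn_einf_ge u l : (\forall n \near \oo, l <= u n) -> l <= limn_einf u.
Proof.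
move=> ul; rewrite /limn_einf leeNr; apply: limn_esup_le.
by apply: filterS ul => n; rewrite leeN2.
Qed.

End limsup.

(** The exponential is at least [(1 + y / 4) ^+ 2], which contains [y ^+ 2 / 16]; the lower bound on
    [y] gives [y + 34 <= 2 * y] and [C <= y / 32]. *)
Lemma exp_half_dominates (R : realType) (C y : R) : 0 < C -> 34 + 32 * C < y ->
  (y + 34) * (C / 2) < expR (y / 2).
Proof.
move=> C0 Cy.
have -> : y / 2 = y / 4 + y / 4 by field.
rewrite expRD.
have h : 1 + y / 4 <= expR (y / 4) by exact: expR_ge1Dx.
have y0 : 0 <= 1 + y / 4 by lra.
apply: (@lt_le_trans _ _ ((1 + y / 4) * (1 + y / 4))); last exact: ler_pM.
have h1 : (y + 34) * (C / 2) <= y * C.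
  have -> : (y + 34) * (C / 2) = (y + 34) / 2 * C by field.
  by rewrite ler_pM2r//; lra.
apply: (le_lt_trans h1).
have h2 : y * C <= y * (y / 32) by apply: ler_wpM2l; lra.
apply: (le_lt_trans h2).
have := sqr_ge0 y; rewrite expr2.
set z := y * y.
have -> : y * (y / 32) = z / 32 by rewrite /z; field.
have -> : (1 + y / 4) * (1 + y / 4) = 1 + y / 2 + z / 16 by rewrite /z; field.
lra.
Qed.

Lemma window_le (R : realType) (k l : nat) :
  (l + (k + l).+1)%:R <= 2 * (k + l).+1%:R :> R.
Proof. by rewrite -natrM ler_nat mul2n -addnn leq_add2r leqW// leq_addl. Qed.

Section lower_bound.
Context (R : realType) (p : R).
Hypothesis hp : 0 < p < 1.
Notation mu := (1 - p).

Lemma waste_rate_bound (lambda : R) (I : input R) (pi : policy I) (q0 : nat)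
    (W kappa : R) (K L : nat) :
  admission_input p lambda I -> mu < lambda < 1 -> 0 <= W ->
  causal pi W -> feasible pi p lambda -> (avg_queue pi q0 < kappa%:E)%E ->
  4 * kappa <= K.+1%:R -> W + 1 <= L%:R / 32 ->
  (mu / (lambda + mu)) ^+ (K + L).+1 <=
    4 * (L + (K + L).+1)%:R * (1 - lambda) / (lambda + mu).
Proof.
move=> hI /andP[mul l1] hW hpi hf hq kK WL; have /andP[p0 p1] := hp.
have lambda0 : 0 < lambda by lra.
have rt0 : 0 < lambda + mu by lra.
have mdiv := causal_measurable hI lambda0 p1 hpi.
pose e n := mean (joint_prob pi) (fun x => (queue_after q0 n x)%:R).
pose h n := mean (joint_prob pi) (fun x => (@H _ I pi n x)%:R).
pose w n := mean (joint_prob pi) (fun x => (@wasted _ I pi q0 n x)%:R).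
(* Feasibility lets diversions exceed the drift by [p - (lambda - mu) = 1 - lambda] per unit of
   time; a second [1 - lambda] is slack for passing from the limsup to all large [N]. Dividing by
   [lambda + mu] converts to a rate per event. *)
pose delta := 2 * (1 - lambda) / (lambda + mu).
have key : (mu / (lambda + mu)) ^+ (K + L).+1 / 2 <= (L + (K + L).+1)%:R * delta.
  apply: (@drift_bound R e h w (lambda / (lambda + mu)) (mu / (lambda + mu)) kappa
    _ K.+1%:R^-1).
  - by move=> n; exact: mean_ge0.
  - by move=> n; exact: mean_ge0.
  - by move=> n; exact: (balance hI lambda0 p1 q0 mdiv).
  - by rewrite exprn_ge0// divr_ge0// ltW// subr_gt0.
  - by [].
  - by rewrite mulrC ler_pdivrMr//; lra.
  - by move=> n; apply: (lookahead_waste hI lambda0 p1 q0 hW hpi) => //; exact: ltW.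
  - have := limn_esup_lt hq; apply: filterS => -[|N].
      by move=> _; rewrite big_ord0 mulr0.
    rewrite (expect_queue hI lambda0 p1)// lte_fin => /ltW.
    by rewrite ler_pdivrMl// mulrC.
  - have : (limn_esup (fun N => ((lambda + 1 - p) / N%:R)%:E *
       expect (fun x => (\sum_(n < N) (@H _ I pi n x)%:R)%R)) < (p + (1 - lambda))%:E)%E.
      by apply: le_lt_trans hf _; rewrite lte_fin; lra.
    move=> /limn_esup_lt; apply: filterS => -[|N].
      by move=> _; rewrite big_ord0 mulr0.
    rewrite (expect_diversions hI lambda0 p1)// -EFinM lte_fin => /ltW.
    rewrite mulrAC ler_pdivrMr// => g.
    have -> : lambda / (lambda + mu) - mu / (lambda + mu) + delta =
        (p + (1 - lambda)) / (lambda + mu).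
      by rewrite /delta; field; rewrite gt_eqF.
    rewrite mulrAC ler_pdivlMr//; apply: le_trans g.
    by rewrite mulrC addrA.
have -> : 4 * (L + (K + L).+1)%:R * (1 - lambda) / (lambda + mu) =
    2 * ((L + (K + L).+1)%:R * delta).
  by rewrite /delta; field; rewrite gt_eqF.
by rewrite [leRHS]mulrC -ler_pdivrMr//; exact: key.
Qed.

Lemma lower_bound : exists cl c l1 : R, [/\ 0 < cl, 0 < c, l1 < 1 &
  forall (lambda : R) (I : input R) (q0 : nat) (W : R),
    admission_input p lambda I -> mu < lambda -> l1 < lambda < 1 -> 0 <= W ->
    W <= cl * ln (1 / (1 - lambda)) ->
    ((c * ln (1 / (1 - lambda)))%:E <= Qopt I p lambda W q0)%E].
Proof.
have /andP[p0 p1] := hp.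
have mu0 : 0 < mu by lra.
(* A run of [m <= D * ell + 34] services has probability at least
   [expR (- g * m)], hence at least a multiple of [sqrt (1 - lambda)]. *)
pose g : R := ln (2 / mu).
have g0 : 0 <= g by apply: ln_ge0; rewrite ler_pdivlMr//; lra.
pose D : R := (2 * g + 1)^-1.
have D0 : 0 < D by rewrite invr_gt0; lra.
have D1 : D <= 1 by rewrite invf_le1; lra.
have Dg : D * g <= 2^-1.
  rewrite /D mulrC ler_pdivrMr; lra.
(* [C] gathers the constants of the final comparison. [l1] below is the bound that
   [exp_half_dominates] requires of [ell]; in terms of [lambda] it becomes [1 - expR (- l1)]. *)
pose C : R := 16 / mu * expR (34 * g).
have C0 : 0 < C by rewrite mulr_gt0 ?expR_gt0// divr_gt0.
pose l1 : R := 34 + 32 * C.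
(* These make [K <= D * ell / 2] and [L <= 32 * (W + 1) + 1 <= D * ell / 2 + 33], whence the run
   length [K + L + 1 <= D * ell + 34]. *)
exists (D / 64), (D / 8), (1 - expR (- l1)); split; try lra.
  by rewrite ltrBlDr ltrDl expR_gt0.
move=> lambda I q0 W hI mul /andP[ll1 l1'] hW Wcl.
set ell := ln (1 / (1 - lambda)) in Wcl *.
have lam1 : 0 < 1 - lambda by lra.
have ellE : 1 - lambda = expR (- ell).
  by rewrite /ell div1r lnV ?posrE// opprK lnK// posrE.
have l1ell : l1 < ell.
  by rewrite -ltrN2 -ltr_expR -ellE; lra.
have ell0 : 0 < ell by apply: lt_trans l1ell; rewrite /l1; lra.
apply: le_ereal_inf_tmp => _ [pi [hpi hf ->]].
rewrite leNgt; apply/negP => hq.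
pose K := Num.truncn (4 * (D / 8 * ell)).
pose L := (Num.truncn (32 * (W + 1))).+1.
have kK : 4 * (D / 8 * ell) <= K.+1%:R by rewrite ltW// truncnS_gt.
have K0 : K%:R <= 4 * (D / 8 * ell).
  by rewrite truncn_le// !mulr_ge0// ltW.
have WL : W + 1 <= L%:R / 32.
  by rewrite ler_pdivlMr// mulrC ltW// truncnS_gt.
have L0 : L%:R <= 32 * (W + 1) + 1.
  by rewrite /L -natr1 lerD2r truncn_le//; lra.
have := waste_rate_bound hI _ hW hpi hf hq kK WL.
rewrite mul l1' => /(_ isT).
apply/negP; rewrite -ltNge.
have rt : mu < lambda + mu by lra.
have rt2 : lambda + mu <= 2 by lra.
pose m : R := (K + L).+1%:R.
have mE : m <= D * ell + 34.
  have -> : m = K%:R + L%:R + 1 by rewrite /m -natr1 natrD.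
  move: K0 L0 Wcl; set k := K%:R; set l := L%:R; lra.
have Lm : (L + (K + L).+1)%:R <= 2 * m by exact: window_le.
have step1 : 4 * (L + (K + L).+1)%:R * (1 - lambda) / (lambda + mu) <=
    8 / mu * (ell + 34) * expR (- ell).
  have h1 : (1 - lambda) / (lambda + mu) <= (1 - lambda) / mu.
    by rewrite ler_pM2l// lef_pV2 ?posrE// ?ltW// (lt_trans mu0).
  have h2 : 4 * (L + (K + L).+1)%:R <= 4 * (2 * (ell + 34)) :> R.
    rewrite ler_pM2l//; apply: (le_trans Lm); rewrite ler_pM2l//.
    apply: (le_trans mE); rewrite lerD2r -[leRHS]mul1r.
    by apply: ler_wpM2r => //; exact: ltW.
  rewrite -ellE -mulrA; apply: (le_trans (ler_pM _ _ h2 h1)) => //.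
    by rewrite divr_ge0// ?ltW// (lt_trans mu0).
  by rewrite le_eqVlt; apply/orP; left; apply/eqP; field; rewrite gt_eqF.
have step2 : expR (- (ell / 2 + 34 * g)) <= (mu / (lambda + mu)) ^+ (K + L).+1.
  apply: (@le_trans _ _ ((mu / 2) ^+ (K + L).+1)).
    have -> : mu / 2 = expR (- g).
      by rewrite /g expRN lnK ?invf_div// posrE divr_gt0.
    rewrite -expRM_natl ler_expR mulrN lerN2 -/m.
    have h1 : m * g <= (D * ell + 34) * g by exact: ler_wpM2r.
    have h2 : D * g * ell <= 2^-1 * ell by apply: ler_wpM2r => //; exact: ltW.
    move: h1 h2; rewrite mulrDl mulrAC; lra.
  apply: lerXn2r; rewrite ?nnegrE ?divr_ge0//; try exact: ltW.
  - by rewrite ltW// (lt_trans mu0).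
  - by rewrite ler_pM2l// lef_pV2// posrE// (lt_trans mu0).
apply: le_lt_trans step1 (lt_le_trans _ step2).
have -> : expR (- ell) = expR (- (ell / 2 + 34 * g)) * (expR (34 * g) / expR (ell / 2)).
  by rewrite -expRN -!expRD; congr expR; field.
rewrite mulrCA -[ltRHS]mulr1 ltr_pM2l ?expR_gt0// mulrA ltr_pdivrMr ?expR_gt0// mul1r.
have -> : 8 / mu * (ell + 34) * expR (34 * g) = (ell + 34) * (C / 2).
  by rewrite /C; field; rewrite gt_eqF.
exact: exp_half_dominates.
Qed.

End lower_bound.

(** * Threshold policy and upper bound *)

Section threshold.
Context (R : realType) (p lambda : R) (I : input R).
Hypothesis hI : admission_input p lambda I.
Hypotheses (lambda0 : 0 < lambda) (p1 : p < 1).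
Variables (q0 L : nat).
Notation mu := (1 - p).

(** Computed from the input alone, since [queue_after] takes as argument the policy that is being
    defined. *)
Fixpoint threshold_queue n (w : ispace I) : nat :=
  if n is m.+1 then
    let q := threshold_queue m w in
    if is_arrival m w then (if (L <= q)%N then q else q.+1) else q.-1
  else q0.

Definition threshold_policy : policy I :=
  {| rspace := unit; rprob := \d_tt;
     diverts := fun n x => (L <= threshold_queue n x.1)%N |}.

Notation Omega := (ispace I * rspace threshold_policy)%type.
Notation P := (joint_prob threshold_policy).
Notation q := (@queue_after _ I threshold_policy q0).
Notation wasted := (@wasted R I threshold_policy q0).
Notation Ex := (mean P).
Notation upto n := (@upto R I threshold_policy n).

Lemma threshold_queueE n x : q n x = threshold_queue n x.1.
Proof. by elim: n => //= n IH; rewrite /H /= IH; case: (is_arrival n x.1). Qed.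

Lemma divertsE n x : diverts n x = (L <= q n x)%N.
Proof. by rewrite threshold_queueE. Qed.

(** Strong induction: the decision is read off the queue, which [hist_queue] observes once all
    earlier decisions are observed. *)
Lemma threshold_causal (W : R) : 0 <= W -> causal threshold_policy W.
Proof.
move=> hW n t.
suff h : history t (by_time (t - W) n `&` [set x | @diverts _ _ threshold_policy n x]).
  rewrite (_ : [set _ | _] = by_time (t - W) n `&`
    [set x | @diverts _ _ threshold_policy n x])//.
  by apply/seteqP; split => x; rewrite /by_time /setI /mkset lerBrDr => -[].
elim/ltn_ind: n => n IH.
rewrite (_ : _ `&` _ = \bigcup_r (if (L <= r)%N then
    by_time (t - W) n `&` [set x | q n x = r] else set0)).
  apply: hist_bigcup => r; case: ifP => _; last exact: hist0.
  by apply: (hist_queue hI) => //; rewrite gerBl.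
apply/seteqP; split => [x [xb]|x [r _]].
  by rewrite /mkset divertsE => Lq; exists (q n x) => //; rewrite Lq.
by case: ifP => // Lr [xb qr]; split => //; rewrite /mkset divertsE qr.
Qed.

Let mdiv n : measurable [set x | @diverts _ _ threshold_policy n x].
Proof. exact: (causal_measurable hI lambda0 p1 (threshold_causal (lexx 0))). Qed.

(** Threshold decisions use no future event; through [upto_service] this makes the queue before an
    event independent of the mark of that event. *)
Lemma threshold_upto n k : upto n [set x | q n x = k].
Proof.
have sI m C D : upto m C -> upto m D -> upto m (C `&` D).
  by rewrite -(@upto_g R I threshold_policy);
    exact: (@measurableI _ (g_sigma_algebraType (upto m))).
have s0 m : upto m set0 by have [] := @upto_sigma_algebra R I threshold_policy m.
have sT m : upto m setT.
  by rewrite -(@upto_g R I threshold_policy);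
    exact: (@measurableT _ (g_sigma_algebraType (upto m))).
have sC m C : upto m C -> upto m (~` C).
  by rewrite -(@upto_g R I threshold_policy);
    exact: (@measurableC _ (g_sigma_algebraType (upto m))).
elim: n k => [|n IH] k.
  have [->|kq] := eqVneq k q0.
    by rewrite (_ : [set _ | _] = setT)//; apply/seteqP; split.
  rewrite (_ : [set _ | _] = set0)//; apply/seteqP; split => x //= /esym/eqP.
  by rewrite (negbTE kq).
pose nx r (a : bool) := if a then if (L <= r)%N then r else r.+1 else r.-1.
pose part r (a : bool) : set Omega := if nx r a == k then [set x | q n x = r] `&`
  (if a then [set x | is_arrival n x.1] else ~` [set x | is_arrival n x.1]) else set0.
rewrite (_ : [set _ | _] = \bigcup_r (part r true `|` part r false)); last first.
  apply/seteqP; split => x.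
  - move=> qx; exists (q n x) => //.
    have xp : part (q n x) (is_arrival n x.1) x.
      rewrite /part ifT; last first.
        by rewrite -qx /= /nx /H divertsE; case: (is_arrival n x.1).
      by split => //; case: ifPn => // /negP.
    by move: xp; case: (is_arrival n x.1) => xp; [left|right].
  - move=> [r _ hx].
    have key a : part r a x -> q n.+1 x = k.
      rewrite /part; case: eqP => // <- [qr sa] /=.
      have -> : is_arrival n x.1 = a.
        by case: a sa => //= sa; apply/negbTE/negP.
      by rewrite /H divertsE qr /nx; case: a sa => //= ->.
    by case: hx; exact: key.
have ar := @upto_arrival R p lambda I hI threshold_policy n.
have hpart r a : upto n.+1 (part r a).
  rewrite /part; case: ifP => _ //; apply: sI; first exact: (uptoS hI).
  by case: a => //; exact: sC.
rewrite -(@upto_g R I threshold_policy).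
apply: (@bigcupT_measurable _ (g_sigma_algebraType (upto n.+1))) => r.
apply: (@measurableU _ (g_sigma_algebraType (upto n.+1)));
  by rewrite /measurable /= -[X in X _]/(<<s upto n.+1 >>) upto_g.
Qed.

Let a : R := lambda / (lambda + mu).
Let b : R := mu / (lambda + mu).

Let mu0 : 0 < mu. Proof. by rewrite subr_gt0. Qed.
Let rt0 : 0 < lambda + mu. Proof. by rewrite addr_gt0. Qed.
Let b0 : 0 < b. Proof. by rewrite divr_gt0. Qed.
Let ab1 : a + b = 1.
Proof. by rewrite /a /b -mulrDl divff// gt_eqF. Qed.

Let bmq n (g : nat -> R) : bounded_measurable (fun x => g (q n x)).
Proof. exact: (bm_queue hI lambda0 p1 q0 mdiv). Qed.

Let bms n : bounded_measurable (fun x : Omega => (~~ is_arrival n x.1)%:R : R).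
Proof. by apply: bm_bool; exact: (service_measurable hI lambda0 p1). Qed.

(** The variable is a combination of indicators of the values of the queue, each independent of the
    next mark. *)
Lemma mean_service_queue n (g : nat -> R) :
  Ex (fun x => (~~ is_arrival n x.1)%:R * g (q n x)) = b * Ex (fun x => g (q n x)).
Proof.
pose ind k x : R := (q n x == k)%:R.
have mk k : measurable [set x | (q n x == k)%N].
  rewrite (_ : [set _ | _] = [set x | q n x = k]).
    exact: (queue_measurable hI lambda0 p1 q0 mdiv).
  by apply/seteqP; split => x /= /eqP.
have bind k : bounded_measurable (ind k) by exact: bm_bool.
have gE x : g (q n x) = \sum_(k <- iota 0 (q0 + n).+1) g k * ind k x.
  have qx : q n x \in iota 0 (q0 + n).+1.
    by rewrite mem_iota add0n ltnS leq0n (queue_growth q0 0 n x).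
  rewrite [RHS](bigD1_seq (q n x) qx (iota_uniq _ _)) [RHS]/= /ind eqxx mulr1.
  by rewrite big1 ?addr0// => k /negbTE; rewrite eq_sym => ->; rewrite mulr0.
rewrite [in RHS](_ : (fun _ => _) = fun x => \sum_(k <- iota 0 (q0 + n).+1) g k * ind k x);
  last by apply/funext.
rewrite [in LHS](_ : (fun _ => _) = fun x => \sum_(k <- iota 0 (q0 + n).+1)
    g k * ((~~ is_arrival n x.1)%:R * ind k x)); last first.
  by apply/funext => x; rewrite gE mulr_sumr; apply: eq_bigr => k _; rewrite mulrCA.
rewrite !mean_sum; last 2 first.
- by move=> k; exact: bmZ.
- by move=> k; apply: bmZ; exact: bmM.
rewrite mulr_sumr; apply: eq_bigr => k _.
rewrite !meanZ//; last exact: bmM.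
rewrite mulrCA; congr (_ * _); apply: EFin_inj.
rewrite EFinM mean_bool//.
rewrite (_ : (fun _ => _) = fun x => (~~ is_arrival n x.1 && (q n x == k))%:R); last first.
  by apply/funext => x; rewrite /ind -natrM mulnb.
have e : [set x | ~~ is_arrival n x.1 && (q n x == k)] =
    [set x | q n x = k] `&` [set x | ~~ is_arrival n x.1].
  by apply/seteqP; split => x /=; [move=> /andP[? /eqP]|move=> [/eqP -> ->]].
rewrite mean_bool; last first.
  rewrite e; apply: measurableI; last exact: (service_measurable hI lambda0 p1).
  exact: (queue_measurable hI lambda0 p1 q0 mdiv).
rewrite e (upto_service hI lambda0 p1 (@threshold_upto n k)).
congr (_ * P _)%E.
by apply/seteqP; split => x /= /eqP.
Qed.

Lemma mean_arrival_queue n (g : nat -> R) :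
  Ex (fun x => (is_arrival n x.1)%:R * g (q n x)) = a * Ex (fun x => g (q n x)).
Proof.
have -> : a = 1 - b by rewrite -ab1 addrK.
have bg := bmq n g; have bsg := bmM (bms n) bg.
rewrite mulrBl mul1r -mean_service_queue -meanN// -meanD//; last exact: bmN.
congr mean; apply/funext => x; case: (is_arrival n x.1) => /=; ring.
Qed.

Let up k := if (L <= k)%N then k else k.+1.

Lemma mean_queueS n (g : nat -> R) : Ex (fun x => g (q n.+1 x)) =
  Ex (fun x => a * g (up (q n x)) + b * g (q n x).-1).
Proof.
have bar : bounded_measurable (fun x : Omega => (is_arrival n x.1)%:R : R).
  by apply: bm_bool; exact: (arrival_measurable hI lambda0 p1).
rewrite meanD; [|exact: (bmq n (fun k => a * g (up k)))|exact: (bmq n (fun k => b * g k.-1))].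
rewrite meanZ; last exact: (bmq n (fun k => g (up k))).
rewrite meanZ; last exact: (bmq n (fun k => g k.-1)).
rewrite -(mean_arrival_queue n (fun k => g (up k))) -(mean_service_queue n (fun k => g k.-1)).
rewrite -meanD; last 2 first.
- by apply: bmM => //; exact: (bmq n (fun k => g (up k))).
- by apply: bmM => //; exact: (bmq n (fun k => g k.-1)).
congr mean; apply/funext => x /=; rewrite /H divertsE /up.
by case: (is_arrival n x.1) => /=; rewrite ?mul1r ?mul0r ?addr0 ?add0r//; case: ifP.
Qed.

(** The queue may start above [L], but its excess never grows and every token reduces it: the
    expected number of events that find the queue above [L] is at most [q0 / b], and each adds at
    most [q0]. *)
Lemma sum_mean_queue N :
  \sum_(n < N) Ex (fun x => (q n x)%:R) <= L%:R * N%:R + q0%:R * q0%:R / b.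
Proof.
pose y n := Ex (fun x => (q n x - L)%N%:R).
pose z n := Ex (fun x => (L < q n x)%N%:R).
have step n : y n.+1 = y n - b * z n.
  rewrite /y (mean_queueS n (fun k => (k - L)%N%:R)) /z.
  have b1 := bmq n (fun k => (k - L)%N%:R).
  have b2 := bmq n (fun k => (L < k)%N%:R).
  have b3 := bmZ b b2.
  rewrite -meanZ// -meanN// -meanD//; last exact: bmN.
  congr mean; apply/funext => x; move: (q n x) => k; rewrite /up.
  have -> : ((if (L <= k)%N then k else k.+1) - L = k - L)%N by case: ifP; lia.
  have [Lk|kL] := ltnP L k.
    have -> : (k - L)%N%:R = (k.-1 - L)%N%:R + 1 :> R by rewrite natr1; congr _%:R; lia.
    by rewrite (_ : a = 1 - b) ?mulr1//=; [ring|rewrite -ab1 addrK].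
  have -> : (k - L = 0)%N by lia.
  have -> : (k.-1 - L = 0)%N by lia.
  by rewrite !mulr0 addr0 subr0.
have tele M : b * \sum_(n < M) z n = y 0%N - y M.
  elim: M => [|M IH]; first by rewrite big_ord0 mulr0 subrr.
  by rewrite big_ord_recr /= mulrDr IH step; ring.
have y0 : y 0%N <= q0%:R.
  rewrite /y -[leRHS](mean_cst P); apply: mean_le.
  - exact: (bmq 0 (fun k => (k - L)%N%:R)).
  - exact: bm_cst.
  by move=> x /=; rewrite ler_nat leq_subr.
have exc n x : (q n x - L <= q0)%N.
  elim: n => [|n IH] /=; first exact: leq_subr.
  by rewrite /H divertsE; case: (is_arrival n x.1) => /=; [case: (leqP L (q n x)) => h|]; lia.
have le n : Ex (fun x => (q n x)%:R) <= L%:R + q0%:R * z n.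
  rewrite /z -meanZ; last exact: (bmq n (fun k => (L < k)%N%:R)).
  rewrite -[X in _ <= X + _](mean_cst P) -meanD; last 2 first.
  - exact: bm_cst.
  - exact: (bmq n (fun k => q0%:R * (L < k)%N%:R)).
  apply: mean_le.
  - exact: (bmq n (fun k => k%:R)).
  - exact: (bmq n (fun k => L%:R + q0%:R * (L < k)%N%:R)).
  move=> x; have := exc n x; case: (ltnP L (q n x)) => h e.
    by rewrite mulr1 -natrD ler_nat; lia.
  by rewrite mulr0 addr0 ler_nat.
apply: (@le_trans _ _ (\sum_(n < N) (L%:R + q0%:R * z n))).
  by apply: ler_sum => n _; exact: le.
rewrite big_split /= sumr_const card_ord -[L%:R *+ N]mulr_natr lerD2l -mulr_sumr -mulrA.
apply: ler_wpM2l => //; rewrite ler_pdivlMr// mulrC tele.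
by rewrite lerBlDr (le_trans y0)// lerDl mean_ge0.
Qed.

Hypothesis mul : mu < lambda.

Lemma sum_mean_empty N :
  (a - b) * \sum_(n < N) Ex (fun x => (q n x == 0)%N%:R) <=
  1 + N%:R * ((a - b) * (mu / lambda) ^+ L).
Proof.
pose r : R := mu / lambda.
have r0 : 0 < r by rewrite divr_gt0.
have r1 : r <= 1 by rewrite ler_pdivrMr// mul1r ltW.
have br : b = a * r by rewrite /b /a /r; field; rewrite !gt_eqF.
have ab : 0 <= a - b by rewrite br -{1}[a]mulr1 -mulrBr mulr_ge0 ?subr_ge0//;
  exact/ltW/divr_gt0.
(* [r ^+ q] is a martingale as long as the queue is neither empty nor full. *)
pose g (k : nat) := r ^+ k.
pose e n := Ex (fun x => g (q n x)).
pose z n := Ex (fun x => (q n x == 0)%N%:R).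
(* For [L > 0] the drift of [r ^+ q] is [- (a - b)] at an empty queue, 0 for lengths below [L], and
   [(a - b) * r ^+ k] at a length [k >= L]. *)
have step n : e n.+1 <= e n - (a - b) * z n + (a - b) * r ^+ L.
  rewrite /e mean_queueS /z.
  have b1 := bmq n g.
  have b2 := bmq n (fun k => (k == 0)%N%:R).
  have b3 := bmN (bmZ (a - b) b2).
  have b4 : bounded_measurable (fun _ : Omega => (a - b) * r ^+ L : R) by exact: bm_cst.
  rewrite -meanZ// -meanN; last exact: bmZ.
  rewrite -[X in _ <= _ + X](mean_cst P) -meanD// -meanD//; last exact: bmD.
  apply: mean_le; last 1 first.
  move=> x; move: (q n x) => k; rewrite /up /g.
  have rL : 0 <= (a - b) * r ^+ L by rewrite mulr_ge0// exprn_ge0// ltW.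
  have [Lk|kL] := leqP L k.
    have Lr : (a - b) * r ^+ k <= (a - b) * r ^+ L.
      by rewrite ler_wpM2l// ler_wiXn2l// ltW.
    case: k Lk Lr => [|k] Lk Lr /=.
      by move: Lr; rewrite expr0 !mulr1; move: ab1; lra.
    rewrite mulr0 subr0; move: Lr; rewrite exprS; set s := r ^+ k.
    rewrite br; set u := a * r; have -> : a * (r * s) = u * s by rewrite mulrA.
    have -> : (a - u) * (r * s) = u * s - u * (r * s) by rewrite /u; ring.
    have : (a + u) * (r * s) = r * s by rewrite /u -br ab1 mul1r.
    have -> : (a + u) * (r * s) = u * s + u * (r * s) by rewrite /u; ring.
    lra.
  case: k kL => [|k] kL /=.
    by rewrite expr0 expr1 -br !mulr1; move: ab1; lra.
  rewrite mulr0 subr0 !exprS; set s := r ^+ k.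
  have -> : a * (r * (r * s)) = b * (r * s) by rewrite br mulrA.
  have : b * (r * s) + a * (r * s) = r * s by rewrite -mulrDl addrC ab1 mul1r.
  have -> : a * (r * s) = b * s by rewrite br mulrA.
  lra.
- exact: (bmq n (fun k => a * g (up k) + b * g k.-1)).
- by apply: bmD => //; exact: bmD.
have tele M : (a - b) * \sum_(n < M) z n <= e 0%N - e M + M%:R * ((a - b) * r ^+ L).
  elim: M => [|M IH]; first by rewrite big_ord0 mulr0 subrr mul0r addr0.
  rewrite big_ord_recr /= mulrDr -natr1.
  move: IH (step M); set t := (a - b) * r ^+ L; have -> : (M%:R + 1) * t = M%:R * t + t by ring.
  set u := _ * z M; set v := _ * \sum_(_ < _) _; lra.
apply: (le_trans (tele N)); rewrite lerD2r.
have : e 0%N <= 1 by rewrite /e /= mean_cst /g exprn_ile1// ltW.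
have : 0 <= e N by apply: mean_ge0 => x; rewrite /g exprn_ge0// ltW.
lra.
Qed.

(** The balance solved for the diversions: they make up for the drift [a - b] and for the wasted
    tokens, whose expected number is [b] times that of the events at an empty queue. *)
Lemma sum_mean_diversions N :
  \sum_(n < N) Ex (fun x => (@H _ I threshold_policy n x)%:R) <=
  q0%:R + b / (a - b) + N%:R * (a - b + b * (mu / lambda) ^+ L).
Proof.
have ab : 0 < a - b.
  by rewrite subr_gt0 /a /b ltr_pM2r ?invr_gt0.
pose e n := Ex (fun x => (q n x)%:R).
pose z n := Ex (fun x => (q n x == 0)%N%:R).
have hw n : Ex (fun x => (wasted n x)%:R) = b * z n.
  rewrite /z -(mean_service_queue n (fun k => (k == 0)%N%:R)); congr mean.
  by apply/funext => x; rewrite /wasted -natrM mulnb.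
have tele M : \sum_(n < M) Ex (fun x => (@H _ I threshold_policy n x)%:R) =
    e 0%N - e M + M%:R * (a - b) + b * \sum_(n < M) z n.
  elim: M => [|M IH]; first by rewrite !big_ord0; ring.
  rewrite !big_ord_recr /= IH /e (balance hI lambda0 p1 q0 mdiv) hw -/a -/b -natr1.
  ring.
rewrite tele.
have h : b * \sum_(n < N) z n <= b / (a - b) + N%:R * (b * (mu / lambda) ^+ L).
  rewrite -(ler_pM2l ab) mulrCA.
  apply: le_trans (ler_wpM2l (ltW b0) (sum_mean_empty N)) _.
  rewrite le_eqVlt; apply/orP; left; apply/eqP; field; exact: lt0r_neq0.
have : e 0%N <= q0%:R by rewrite /e /= mean_cst.
have : 0 <= e N by exact: mean_ge0.
rewrite mulrDr; lra.
Qed.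

End threshold.

Lemma near_le_mulrn (R : realType) (c e : R) : 0 < e ->
  \forall N \near \oo, c <= e * (N%:R : R).
Proof.
move=> e0; exists (Num.truncn (c / e)).+1 => // N /= cN.
rewrite mulrC -ler_pdivrMr//; apply: (le_trans (ltW (truncnS_gt _))).
by rewrite ler_nat.
Qed.

(** Up to a transient, [lambda - (1 - p) + (1 - p) * ((1 - p) / lambda) ^+ L] jobs are diverted per
    unit of time, which the last hypothesis bounds by [p]. The transient [q0 * q0 / b] in the sum of
    the queue is eventually at most [N], hence [L.+1]. *)
Lemma threshold_bound (R : realType) (p lambda : R) (I : input R) (q0 L : nat) (W : R) :
  admission_input p lambda I -> 0 < p < 1 -> 1 - p < lambda -> 0 <= W ->
  (1 - p) * ((1 - p) / lambda) ^+ L <= 1 - lambda ->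
  (Qopt I p lambda W q0 <= (L.+1%:R)%:E)%E.
Proof.
move=> hI /andP[p0 p1] mul hW hL.
have lambda0 : 0 < lambda by lra.
have mdiv := causal_measurable hI lambda0 p1 (threshold_causal hI (q0 := q0) (L := L) hW).
have rt0 : 0 < lambda + (1 - p) by lra.
apply: (@le_trans _ _ (avg_queue (threshold_policy I q0 L) q0)).
  apply: ereal_inf_lbound; exists (threshold_policy I q0 L); split => //.
    exact: (threshold_causal hI).
  rewrite /feasible; apply/lee_addgt0Pr => e e0; apply: limn_esup_le.
  pose b := (1 - p) / (lambda + (1 - p)).
  pose ab := lambda / (lambda + (1 - p)) - b.
  apply: filterS (near_le_mulrn ((lambda + (1 - p)) * (q0%:R + b / ab)) e0) => -[|N] hN.
    rewrite invr0 mulr0 mul0e adde_ge0// lee_fin ltW//.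
  rewrite (expect_diversions hI lambda0 p1 mdiv) -EFinM -EFinD lee_fin.
  rewrite mulrAC ler_pdivrMr// -addrA.
  have := sum_mean_diversions hI lambda0 p1 q0 L mul N.+1.
  rewrite -/b -/ab => h.
  apply: (le_trans (ler_wpM2l (ltW rt0) h)).
  rewrite mulrDr [leRHS]mulrDl addrC; apply: lerD => //.
  rewrite mulrCA mulrC ler_pM2r//.
  have -> : (lambda + (1 - p)) * (ab + b * ((1 - p) / lambda) ^+ L) =
      lambda - (1 - p) + (1 - p) * ((1 - p) / lambda) ^+ L.
    by rewrite /ab /b; field; rewrite !gt_eqF.
  lra.
apply: limn_esup_le.
pose b := (1 - p) / (lambda + (1 - p)).
apply: filterS (near_le_mulrn (q0%:R * q0%:R / b) (@ltr01 R)) => -[|N] hN.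
  by rewrite (expect_queue hI lambda0 p1 q0 mdiv) invr0 mul0r lee_fin.
rewrite (expect_queue hI lambda0 p1 q0 mdiv) lee_fin ler_pdivrMl//.
apply: (le_trans (sum_mean_queue hI lambda0 p1 q0 L N.+1)).
have -> : N.+1%:R * L.+1%:R = L%:R * N.+1%:R + 1 * N.+1%:R :> R.
  by rewrite -(natr1 L); ring.
by rewrite lerD2l.
Qed.

Lemma upper_bound (R : realType) (p : R) : 0 < p < 1 ->
  exists C l1 : R, [/\ 0 < C, l1 < 1 &
  forall (lambda : R) (I : input R) (q0 : nat) (W : R),
    admission_input p lambda I -> 1 - p < lambda -> l1 < lambda < 1 -> 0 <= W ->
    1 <= ln (1 / (1 - lambda)) /\
    (Qopt I p lambda W q0 <= (C * ln (1 / (1 - lambda)))%:E)%E].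
Proof.
move=> hp; have /andP[p0 p1] := hp.
have mu0 : 0 < 1 - p by lra.
have l00 : 0 < 1 - p / 2 by lra.
(* For [lambda > 1 - p / 2] the ratio [(1 - p) / lambda] is at most [expR (- s)], so a threshold
   just above [ell / s] suffices uniformly in [lambda]. *)
pose s : R := ln ((1 - p / 2) / (1 - p)).
have s0 : 0 < s by apply: ln_gt0; rewrite ltr_pdivlMr//; lra.
(* [L.+1 <= ell / s + 2], and the 2 is absorbed by [1 <= ell], which [lambda > 1 - expR (-1)]
   ensures. *)
exists (s^-1 + 2), (Num.max (1 - p / 2) (1 - expR (-1))); split.
- by rewrite addr_gt0// invr_gt0.
- rewrite gt_max; apply/andP; split; first by lra.
  by rewrite ltrBlDr ltrDl expR_gt0.
move=> lambda I q0 W hI mul; rewrite gt_max => /andP[/andP[l0 l1] l2] hW.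
set ell := ln (1 / (1 - lambda)).
have lam1 : 0 < 1 - lambda by lra.
have ellE : 1 - lambda = expR (- ell).
  by rewrite /ell div1r lnV ?posrE// opprK lnK// posrE.
have ell1 : 1 <= ell.
  by rewrite -lerN2 -ler_expR -ellE; lra.
split => //.
pose L := (Num.truncn (ell / s)).+1.
have Ls : ell <= s * L%:R by rewrite mulrC -ler_pdivrMr// ltW// truncnS_gt.
have LE : L%:R <= ell / s + 1.
  rewrite /L -natr1 lerD2r truncn_le// divr_ge0 ?ltW//; lra.
apply: (@le_trans _ _ (L.+1%:R)%:E); last first.
  rewrite lee_fin -natr1 mulrDl [s^-1 * _]mulrC; move: LE; set u := ell / s; lra.
apply: (threshold_bound q0 hI hp mul hW).
have lam0 : 0 < lambda by lra.
apply: (@le_trans _ _ (((1 - p) / lambda) ^+ L)).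
  rewrite -[leRHS]mul1r ler_wpM2r//; last by lra.
  by rewrite exprn_ge0// divr_ge0// ltW.
rewrite ellE; apply: (@le_trans _ _ (expR (- s) ^+ L)); last first.
  by rewrite -expRM_natl ler_expR mulrN lerN2 mulrC.
apply: lerXn2r; [by rewrite nnegrE divr_ge0// ltW|by rewrite nnegrE expR_ge0|].
rewrite /s expRN lnK ?posrE ?divr_gt0// invf_div.
by rewrite ler_pM2l// lef_pV2 ?posrE// ltW.
Qed.

Theorem theorem1 (R : realType) (p : R) (hp : 0 < p < 1) :
  exists cl lambda0 : R,
    [/\ 0 < cl, 1 - p < lambda0 < 1 &
    forall (W : R -> R) (I : R -> input R) (q0 : R -> nat),
      (forall lambda, 1 - p < lambda < 1 -> 0 <= W lambda) ->
      (forall lambda, 1 - p < lambda < 1 ->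
         admission_input p lambda (I lambda)) ->
      (forall lambda, lambda0 < lambda < 1 ->
         W lambda <= cl * ln (1 / (1 - lambda))) ->
      Theta [set lambda : R | 1 - p < lambda < 1] 1
        (fun lambda => Qopt (I lambda) p lambda (W lambda) (q0 lambda))
        (fun lambda => ln (1 / (1 - lambda)))].
Proof.
have /andP[p0 p1] := hp.
have [cl [c [l1 [cl0 c0 l11 lower]]]] := lower_bound hp.
have [C [l2 [C0 l21 upper]]] := upper_bound hp.
(* A convenient point strictly between [1 - p] and 1; the thresholds [l1] and [l2] enter only
   through the tail of the sequence. *)
exists cl, (1 - p / 2); split => //; first by apply/andP; split; lra.
move=> W I q0 hW hI Wcl x xD x1 r.
have near_x : \forall n \near \oo, ((c%:E <= r n)%E /\ (r n <= C%:E)%E).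
  have : \forall n \near \oo, Num.max (Num.max l1 l2) (1 - p / 2) < x n.
    apply: (cvgr_gt _ x1); rewrite !gt_max l11 l21 /=; lra.
  apply: filterS => n; rewrite !gt_max => /andP[/andP[xl1 xl2] xp].
  have xn := xD n; have /andP[mx x1'] : 1 - p < x n < 1 := xn.
  have xl1' : l1 < x n < 1 by rewrite xl1.
  have xl2' : l2 < x n < 1 by rewrite xl2.
  have xp' : 1 - p / 2 < x n < 1 by rewrite xp.
  have [ell1 up] := upper _ _ (q0 (x n)) _ (hI _ xn) mx xl2' (hW _ xn).
  have lo := lower _ _ (q0 (x n)) _ (hI _ xn) mx xl1' (hW _ xn) (Wcl _ xp').
  rewrite /r; move: ell1 up lo; set ell := ln _; set Qx := Qopt _ _ _ _ _.
  move=> ell1 up lo.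
  have ell0 : 0 < ell by exact: lt_le_trans ell1.
  have li : (0 <= (ell^-1)%:E)%E by rewrite lee_fin invr_ge0 ltW.
  split.
    have := lee_wpmul2r li lo.
    by rewrite -EFinM mulfK// gt_eqF.
  have := lee_wpmul2r li up.
  by rewrite -EFinM mulfK// gt_eqF.
split.
- apply: (@lt_le_trans _ _ c%:E); first by rewrite lte_fin.
  by apply: limn_einf_ge; apply: filterS near_x => n [].
- exact: limn_einf_sup.
- apply: (@le_lt_trans _ _ C%:E); last exact: ltry.
  by apply: limn_esup_le; apply: filterS near_x => n [].
Qed.
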